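(* Let $S$ and $N$ be the south and north poles of $\mathbb{S}^2$, and write $x'=(x_1,x_2)$. Suppose $u\in C^2(\mathbb{S}^2\setminus\{S,N\})$ is a $(-1)$-homogeneous axisymmetric solution of the stationary Navier-Stokes equations $$-\Delta u+(u\cdot\nabla)u+\nabla p=0,\qquad \operatorname{div}u=0,$$ satisfying $$\limsup_{|x|=1,\ x'\to0}\frac{|u(x)|}{|\ln|x'||}<\infty .$$ Then $u_\phi\equiv0$, and $u=u^{c,\gamma}$ for some $(c,\gamma)\in I$ with $c_1=c_2=0$ (where $c=(c_1,c_2,c_3)$), and $$\lim_{x\in\mathbb{S}^2,\ x\to S}\frac{|u(x)|}{\ln|x'|}=\lim_{x\in\mathbb{S}^2,\ x\to N}\frac{|u(x)|}{\ln|x'|}=-2|c_3| .$$ In particular, if $P$ is $S$ or $N$, then there does not exist a $(-1)$-homogeneous axisymmetric solution $u\in C^2(\mathbb{S}^2\setminus\{P\})$ of the stationary Navier-Stokes equations $-\Delta u+(u\cdot\nabla)u+\nabla p=0$, $\operatorname{div}u=0$, satisfying $$0<\limsup_{|x|=1,\ x\to P}\frac{|u(x)|}{|\ln|x'||}<\infty .$$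
   Context: Spherical coordinates $(r,\theta,\phi)$: $r=|x|$, $\theta$ is the angle from the positive $x_3$-axis, $\phi$ is the meridian angle about the $x_3$-axis; $u=u_re_r+u_\theta e_\theta+u_\phi e_\phi$ in the associated orthonormal frame. $N=(0,0,1)$, $S=(0,0,-1)$. A vector field is axisymmetric if $u_r,u_\theta,u_\phi$ do not depend on $\phi$. A function $f$ is $(-k)$-homogeneous if $f(x)=\lambda^kf(\lambda x)$ for all $\lambda>0$; a $(-1)$-homogeneous solution on $\Omega\subset\mathbb{S}^2$ is understood as extended to the cone $\{x: x/|x|\in\Omega\}$ with $u$ $(-1)$-homogeneous and $p$ $(-2)$-homogeneous, the equations holding there. Definition of $u^{c,\gamma}$ and $I$. For $c=(c_1,c_2,c_3)\in\mathbb{R}^3$ with $c_1,c_2\ge-1$ let $$\bar c_3(c_1,c_2)=-\tfrac12\big(\sqrt{1+c_1}+\sqrt{1+c_2}\big)\big(\sqrt{1+c_1}+\sqrt{1+c_2}+2\big),$$ and $J=\{c\in\mathbb{R}^3: c_1\ge-1,\ c_2\ge-1,\ c_3\ge\bar c_3(c_1,c_2)\}$. With $y=\cos\theta$, consider the ordinary differential equation $$(1-y^2)\frac{d}{dy}U_\theta+2yU_\theta+\frac12U_\theta^2=c_1(1-y)+c_2(1+y)+c_3(1-y^2),\qquad y\in(-1,1).\qquad( * )$$ It is known from earlier work (of L. Li, Y. Y. Li and X. Yan) that there are continuous functions $\gamma^-,\gamma^+:J\to\mathbb{R}$, with $\gamma^-(c)<\gamma^+(c)$ if $c_3>\bar c_3(c_1,c_2)$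 and $\gamma^-(c)=\gamma^+(c)$ if $c_3=\bar c_3(c_1,c_2)$, such that for every $c\in J$ and $\gamma^-(c)\le\gamma\le\gamma^+(c)$ equation $( * )$ has a unique solution $U_\theta^{c,\gamma}\in C^\infty(-1,1)\cap C^0[-1,1]$ with $U_\theta^{c,\gamma}(0)=\gamma$. Set $I=\{(c,\gamma)\in\mathbb{R}^4: c\in J,\ \gamma^-(c)\le\gamma\le\gamma^+(c)\}$ and, on $\mathbb{S}^2\setminus\{S,N\}$, $$u^{c,\gamma}=\Big(\frac{d}{dy}U_\theta^{c,\gamma}\Big)e_r+\frac{U_\theta^{c,\gamma}}{\sin\theta}\,e_\theta,\qquad p^{c,\gamma}=\frac{d}{dy}U_\theta^{c,\gamma}-\frac{(U_\theta^{c,\gamma})^2}{2\sin^2\theta}+c_3 .$$ It is known from the same earlier work that $\{(u^{c,\gamma},p^{c,\gamma}):(c,\gamma)\in I\}$ is exactly the set of all $(-1)$-homogeneous axisymmetric solutions in $C^\infty(\mathbb{S}^2\setminus\{S,N\})$ with $u_\phi\equiv0$. *)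

(* Defs.v *)
From HB Require Import structures.
From mathcomp Require Import all_boot all_order all_algebra.
From mathcomp Require Import all_classical all_reals all_analysis.
Set Implicit Arguments.
Unset Strict Implicit.
Unset Printing Implicit Defensive.
Import Order.TTheory GRing.Theory Num.Theory.
Import numFieldNormedType.Exports.
Local Open Scope classical_set_scope.
Local Open Scope ring_scope.

Section Geometry.
Variable R : realType.
Implicit Types (x v w : 'rV[R]_3) (Omega : set 'rV[R]_3).

Definition vec3 (a b c : R) : 'rV[R]_3 := \row_(i < 3) [:: a; b; c]`_i.

Definition unit_vec (i : 'I_3) : 'rV[R]_3 := delta_mx 0 i.

Definition dot v w : R := \sum_i v 0 i * w 0 i.

(* The library norm [`|x|] on row vectors is the sup norm, so the Euclidean
   norm is defined here; both induce the same topology and derivatives. *)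
Definition enorm v : R := Num.sqrt (dot v v).

Definition enorm' x : R := Num.sqrt (x 0 0 ^+ 2 + x 0 1 ^+ 2).

Definition sphere : set 'rV[R]_3 := [set x | enorm x = 1].
Definition north : 'rV[R]_3 := vec3 0 0 1.
Definition south : 'rV[R]_3 := vec3 0 0 (-1).

Definition cone Omega : set 'rV[R]_3 :=
  [set x | x != 0 /\ Omega ((enorm x)^-1 *: x)].

Definition e_r (theta phi : R) : 'rV[R]_3 :=
  vec3 (sin theta * cos phi) (sin theta * sin phi) (cos theta).
Definition e_theta (theta phi : R) : 'rV[R]_3 :=
  vec3 (cos theta * cos phi) (cos theta * sin phi) (- sin theta).
Definition e_phi (theta phi : R) : 'rV[R]_3 :=
  vec3 (- sin phi) (cos phi) 0.

Definition sph (r theta phi : R) : 'rV[R]_3 := r *: e_r theta phi.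

Definition comp_r (u : 'rV[R]_3 -> 'rV[R]_3) (r theta phi : R) : R :=
  dot (u (sph r theta phi)) (e_r theta phi).
Definition comp_theta (u : 'rV[R]_3 -> 'rV[R]_3) (r theta phi : R) : R :=
  dot (u (sph r theta phi)) (e_theta theta phi).
Definition comp_phi (u : 'rV[R]_3 -> 'rV[R]_3) (r theta phi : R) : R :=
  dot (u (sph r theta phi)) (e_phi theta phi).

Definition axisymmetric (u : 'rV[R]_3 -> 'rV[R]_3) : Prop :=
  forall r theta phi psi : R, 0 < r -> 0 < theta < pi ->
  [/\ comp_r u r theta phi = comp_r u r theta psi,
      comp_theta u r theta phi = comp_theta u r theta psi &
      comp_phi u r theta phi = comp_phi u r theta psi].

Definition no_swirl (u : 'rV[R]_3 -> 'rV[R]_3) : Prop :=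
  forall r theta phi : R, 0 < r -> 0 < theta < pi -> comp_phi u r theta phi = 0.

(* (-k)-homogeneity on a cone [C]. *)
Definition homogeneous_on (V : lmodType R) (C : set 'rV[R]_3) (k : nat)
    (f : 'rV[R]_3 -> V) : Prop :=
  forall x (lambda : R), C x -> 0 < lambda ->
  f x = lambda ^+ k *: f (lambda *: x).

(* The filter of the limit [x' -> 0] along [|x| = 1], away from the poles. *)
Definition to_axis : set_system 'rV[R]_3 :=
  filter_from [set d : R | 0 < d]
    (fun d => [set x | sphere x /\ 0 < enorm' x < d]).

(* The filter of the limit [x -> P], [x != P], along the unit sphere. *)
Definition to_pole (P : 'rV[R]_3) : set_system 'rV[R]_3 :=
  within (sphere `\ P) (nbhs P).

End Geometry.

Arguments unit_vec {R}.
Arguments north {R}.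
Arguments south {R}.
Arguments sphere {R}.
Arguments to_axis {R}.

Section NavierStokes.
Variable R : realType.
Implicit Types (C Omega : set 'rV[R]_3).

Definition C1_on (V : normedModType R) C (f : 'rV[R]_3 -> V) : Prop :=
  forall x, C x ->
  differentiable f x /\ forall i, {for x, continuous ('D_(unit_vec i) f)}.

Definition C2_on (V : normedModType R) C (f : 'rV[R]_3 -> V) : Prop :=
  C1_on C f /\ forall i, C1_on C ('D_(unit_vec i) f).

Definition laplacian (u : 'rV[R]_3 -> 'rV[R]_3) (x : 'rV[R]_3) : 'rV[R]_3 :=
  \sum_i 'D_(unit_vec i) ('D_(unit_vec i) u) x.

Definition advection (u : 'rV[R]_3 -> 'rV[R]_3) (x : 'rV[R]_3) : 'rV[R]_3 :=
  \sum_i u x 0 i *: 'D_(unit_vec i) u x.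

Definition gradient (p : 'rV[R]_3 -> R) (x : 'rV[R]_3) : 'rV[R]_3 :=
  \row_i 'D_(unit_vec i) p x.

Definition divergence (u : 'rV[R]_3 -> 'rV[R]_3) (x : 'rV[R]_3) : R :=
  \sum_i ('D_(unit_vec i) u x) 0 i.

Definition stationary_NS C (u : 'rV[R]_3 -> 'rV[R]_3) (p : 'rV[R]_3 -> R) :=
  forall x, C x ->
  - laplacian u x + advection u x + gradient p x = 0 /\ divergence u x = 0.

(* [u] is a C^2 (-1)-homogeneous axisymmetric solution on [Omega], a subset of
   the unit sphere, extended to the cone over [Omega]. *)
Definition homogeneous_axisym_solution Omega (u : 'rV[R]_3 -> 'rV[R]_3) :=
  [/\ C2_on (cone Omega) u, homogeneous_on (cone Omega) 1 u, axisymmetric u &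
      exists p : 'rV[R]_3 -> R,
        [/\ C1_on (cone Omega) p, homogeneous_on (cone Omega) 2 p &
            stationary_NS (cone Omega) u p]].

End NavierStokes.

Section NoSwirlFamily.
Variable R : realType.
Implicit Types U : R -> R.

Definition c3bar (c1 c2 : R) : R :=
  - 2^-1 * (Num.sqrt (1 + c1) + Num.sqrt (1 + c2))
         * (Num.sqrt (1 + c1) + Num.sqrt (1 + c2) + 2).

Definition in_J (c1 c2 c3 : R) : Prop :=
  [/\ -1 <= c1, -1 <= c2 & c3bar c1 c2 <= c3].

(* [U] is in C^oo(-1,1) and C^0[-1,1] and solves the ODE for [U_theta] in the
   variable [y = cos theta]; values of [U] outside [-1,1] are irrelevant. *)
Definition Utheta_ode (c1 c2 c3 : R) U : Prop :=
  [/\ forall n (y : R), -1 < y < 1 -> derivable (derive1n n U) y 1,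
      {within `[-1, 1], continuous U} &
      forall y : R, -1 < y < 1 ->
        (1 - y ^+ 2) * derive1 U y + 2 * y * U y + 2^-1 * U y ^+ 2
        = c1 * (1 - y) + c2 * (1 + y) + c3 * (1 - y ^+ 2)].

Definition ode_initial_values (c1 c2 c3 : R) : set R :=
  [set gamma | exists U, Utheta_ode c1 c2 c3 U /\ U 0 = gamma].

(* For [c] in J the set of initial values at [y = 0] of solutions of the ODE is
   the segment [gamma^-(c), gamma^+(c)] (Li, Li and Yan), so its endpoints
   are the infimum and the supremum of that set. *)
Definition gamma_minus (c1 c2 c3 : R) : R := inf (ode_initial_values c1 c2 c3).
Definition gamma_plus (c1 c2 c3 : R) : R := sup (ode_initial_values c1 c2 c3).

Definition in_I (c1 c2 c3 gamma : R) : Prop :=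
  in_J c1 c2 c3 /\ gamma_minus c1 c2 c3 <= gamma <= gamma_plus c1 c2 c3.

(* [U] is U_theta^{c,gamma}. *)
Definition is_Utheta (c1 c2 c3 gamma : R) U : Prop :=
  [/\ Utheta_ode c1 c2 c3 U, U 0 = gamma &
      forall V, Utheta_ode c1 c2 c3 V -> V 0 = gamma ->
        forall y : R, -1 <= y <= 1 -> V y = U y].

(* [u] coincides with u^{c,gamma} on the sphere minus the two poles. *)
Definition is_u_c_gamma (c1 c2 c3 gamma : R)
    (u : 'rV[R]_3 -> 'rV[R]_3) : Prop :=
  exists2 U, is_Utheta c1 c2 c3 gamma U &
    forall theta phi : R, 0 < theta < pi ->
      u (sph 1 theta phi)
      = derive1 U (cos theta) *: e_r theta phi
        + (U (cos theta) / sin theta) *: e_theta theta phi.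

End NoSwirlFamily.

(* Main.v *)
Require Import Defs.
From mathcomp Require Import all_boot all_order all_algebra.
From mathcomp Require Import all_classical all_reals all_analysis.
From mathcomp Require Import ring lra.
Import Order.TTheory GRing.Theory Num.Theory.
Import numFieldNormedType.Exports.
Local Open Scope classical_set_scope.
Local Open Scope ring_scope.

Set Implicit Arguments.
Unset Strict Implicit.

(** Proof idea. On the meridian half-planes write [u = (f e_r + g e_theta + h
    e_phi) / r] with [f], [g], [h] functions of the polar angle [theta]. The
    gradient of a homogeneous function at a point of the sphere is determined
    by its degree and by its two angular derivatives ([gradient_sph]); applied
    to [u], then to the partial derivatives of [u], then to [p], this turns the
    Navier-Stokes system into ordinary differential equations
    ([reduced_system]). The pressure does not depend on the meridian angle,
    because its derivative in that angle is constant along each parallel and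
    the pressure is periodic.

    No swirl ([swirl_vanishes]): [h sin theta] tends to [0] at both poles by
    the logarithmic bound, so its derivative vanishes somewhere; divided by
    [sin theta] that derivative solves [k' = g k], hence [k = 0] and
    [h sin theta] is constant, equal to [0].

    Riccati equation: with [h = 0] the system integrates explicitly
    ([first_integral]), and [U = g sin theta], as a function of
    [y = cos theta], satisfies [(1 - y^2) U' + 2 y U + U^2 / 2
    = a + b y + c_3 (1 - y^2)]. As [|u| = O(|ln |x'||)], the left-hand side
    vanishes at [y = 1] and [y = -1], so [a = b = 0], that is
    [c_1 = c_2 = 0] ([polar_Utheta]).

    Membership in [I]: if [c_3 < -4], the function [(1 - y^2) (U + 4 y)],
    which compares [U] with the solution [-4 y] for [c_3 = -4], would decrease
    strictly from [0] to [0] ([c3_lower_bound]). The values [U(0)] of all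
    solutions with given [c_3] are bounded by [2 + |c_3|]
    ([initial_value_bound]), so the infimum and the supremum that define
    [gamma^-] and [gamma^+] enclose [U(0)].

    Limit at the poles ([speed_asymptotics]): [V = U / (1 - y^2)] satisfies
    [V' = c_3 / (1 - y^2) - V^2 / 2] and is [O(ln (1 - y))] at [y = 1], so the
    quadratic term is negligible, [V ~ - c_3 ln |x'|] and [U' ~ 2 c_3 ln |x'|],
    while the [theta]-component [U / sin theta] stays [o(ln |x'|)]. The
    symmetry [U(y) -> - U(-y)] gives the other pole.

    Last assertion ([one_pole_regular]): if [u] is regular across one pole the
    limit there is [0], so [c_3 = 0], and then the limit at the other pole is
    [0] as well. *)

(** * Differentiation of compound expressions *)

Section DerivativeRules.
Variable R : realType.
Implicit Types (f g : R -> R) (a b x : R).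

Lemma isd_eq f x a b : is_derive x (1 : R) f a -> a = b -> is_derive x (1 : R) f b.
Proof. by move=> ? <-. Qed.

(** The rules below concern applied functions [fun t => f t + g t] and give the
    derivative as a ring expression, so that the tactic [isd] can chain them by
    following the syntax and [ring] or [field] can compare the outcome. *)
Lemma isd_cst (c x : R) : is_derive x (1 : R) (fun=> c) 0.
Proof. exact: is_derive_cst. Qed.

Lemma isd_id x : is_derive x (1 : R) (fun t => t) 1.
Proof. exact: is_derive_id. Qed.

Lemma isdD f g x a b : is_derive x (1 : R) f a -> is_derive x (1 : R) g b ->
  is_derive x (1 : R) (fun t => f t + g t) (a + b).
Proof. by move=> fa gb; exact: is_deriveD. Qed.

Lemma isdN f x a : is_derive x (1 : R) f a ->
  is_derive x (1 : R) (fun t => - f t) (- a).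
Proof. by move=> fa; exact: is_deriveN. Qed.

Lemma isdM f g x a b : is_derive x (1 : R) f a -> is_derive x (1 : R) g b ->
  is_derive x (1 : R) (fun t => f t * g t) (a * g x + f x * b).
Proof.
move=> fa gb; apply: (is_derive_eq (is_deriveM fa gb)); rewrite /GRing.scale /=; ring.
Qed.

Lemma isdX f x a n : is_derive x (1 : R) f a ->
  is_derive x (1 : R) (fun t => f t ^+ n) (n%:R * f x ^+ n.-1 * a).
Proof.
move=> fa; have -> : (fun t => f t ^+ n) = f ^+ n by apply/funext => t; rewrite fctE.
by apply: (is_derive_eq (is_deriveX n fa)).
Qed.

Lemma isdV f x a : f x != 0 -> is_derive x (1 : R) f a ->
  is_derive x (1 : R) (fun t => (f t)^-1) (- (f x) ^- 2 * a).
Proof. by move=> fx0 fa; apply: is_derive_eq (is_deriveV fx0 fa) _. Qed.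

Lemma isd_comp f g x a b : is_derive x (1 : R) g a -> is_derive (g x) (1 : R) f b ->
  is_derive x (1 : R) (fun t => f (g t)) (b * a).
Proof.
move=> ga fb; have := is_derive1_comp fb ga.
by move=> H; apply: is_derive_eq H _; rewrite mulrC.
Qed.

Lemma isd_val f x a : is_derive x (1 : R) f a -> derive1 f x = a.
Proof. by move=> fa; rewrite derive1E; exact: derive_val. Qed.

Lemma isdP f x : derivable f x 1 -> is_derive x (1 : R) f (derive1 f x).
Proof. by move=> fa; rewrite derive1E; apply/derivableP. Qed.

Lemma isd_unique f x a b :
  is_derive x (1 : R) f a -> is_derive x (1 : R) f b -> a = b.
Proof. by move=> /isd_val <- /isd_val <-. Qed.

Lemma isd_ext f g (u v x a : R) : u < x < v ->
  (forall t, u < t < v -> f t = g t) ->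
  is_derive x (1 : R) f a -> is_derive x (1 : R) g a.
Proof.
move=> xuv fg; apply: near_eq_is_derive.
have : x \in `]u, v[ by rewrite in_itv.
move/near_in_itvoo; apply: filterS => t; rewrite in_itv /=; exact: fg.
Qed.

End DerivativeRules.

(** [notypeclasses] keeps instance search from solving the intermediate goals:
    it would fill in derivatives written with scalings, which [ring] does not
    normalise. *)
Ltac isd :=
  lazymatch goal with
  | |- is_derive _ _ (fun _ => ?c) _ => notypeclasses refine (isd_cst _ _)
  | |- is_derive _ _ (fun t => t) _ => notypeclasses refine (isd_id _)
  | |- is_derive _ _ GRing.inv _ =>
         notypeclasses refine (@isdV _ (fun t => t) _ _ _ (isd_id _))
  | |- is_derive _ _ ( *%R ?c) _ => notypeclasses refine (isdM (isd_cst c _) (isd_id _))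
  | |- is_derive _ _ ( +%R ?c) _ => notypeclasses refine (isdD (isd_cst c _) (isd_id _))
  | |- is_derive _ _ -%R _ => notypeclasses refine (isdN (isd_id _))
  | |- is_derive _ _ sin _ => exact: is_derive_sin
  | |- is_derive _ _ cos _ => exact: is_derive_cos
  | |- is_derive _ _ (fun t => @?f t + @?g t) _ =>
         notypeclasses refine (isdD _ _); isd
  | |- is_derive _ _ (fun t => - @?f t) _ => notypeclasses refine (isdN _); isd
  | |- is_derive _ _ (fun t => @?f t * @?g t) _ =>
         notypeclasses refine (isdM _ _); isd
  | |- is_derive _ _ (fun t => @?f t ^+ ?n) _ =>
         notypeclasses refine (isdX _ _); isd
  | |- is_derive _ _ (fun t => (@?f t)^-1) _ =>
         notypeclasses refine (isdV _ _); isd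
  | |- is_derive _ _ (fun t => sin (@?f t)) _ =>
         notypeclasses refine (@isd_comp _ sin f _ _ _ _ (is_derive_sin _)); isd
  | |- is_derive _ _ (fun t => cos (@?f t)) _ =>
         notypeclasses refine (@isd_comp _ cos f _ _ _ _ (is_derive_cos _)); isd
  | |- is_derive _ _ (fun t => expR (@?f t)) _ =>
         notypeclasses refine (@isd_comp _ expR f _ _ _ _ (is_derive_expR _)); isd
  | |- _ => first [eassumption | solve [eauto] | idtac]
  end.

Ltac isd_by := notypeclasses refine (isd_eq _ _); [isd | cbv beta].

(** * The spherical frame *)

Section Frame.
Variable R : realType.
Implicit Types (t p r : R) (i j : 'I_3).

(** Coordinates of the frame [e_r], [e_theta], [e_phi]; the last one depends on
    the meridian angle only. *)
Definition er t p i : R := e_r t p 0 i.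
Definition et t p i : R := e_theta t p 0 i.
Definition ep p i : R := e_phi 0 p 0 i.

Lemma sum3 (F : 'I_3 -> R) : \sum_i F i = F 0 + F 1 + F 2%:R.
Proof.
rewrite !big_ord_recl big_ord0 addr0 addrA.
by congr (F _ + F _ + F _); apply/val_inj.
Qed.

Ltac expand_coords := rewrite !sum3 /er /et /ep !mxE /=.

Lemma er_dt t p i : is_derive t (1 : R) (fun t => er t p i) (et t p i).
Proof.
rewrite /er /et.
case: i => -[|[|[|//]]] /= ?; under eq_fun do rewrite !mxE /=; rewrite !mxE /=;
  (isd_by; ring).
Qed.

Lemma et_dt t p i : is_derive t (1 : R) (fun t => et t p i) (- er t p i).
Proof.
rewrite /er /et.
case: i => -[|[|[|//]]] /= ?; under eq_fun do rewrite !mxE /=; rewrite !mxE /=;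
  (isd_by; ring).
Qed.

Lemma er_dp t p i : is_derive p (1 : R) (fun p => er t p i) (sin t * ep p i).
Proof.
rewrite /er /ep.
case: i => -[|[|[|//]]] /= ?; under eq_fun do rewrite !mxE /=; rewrite !mxE /=;
  (isd_by; ring).
Qed.

Lemma et_dp t p i : is_derive p (1 : R) (fun p => et t p i) (cos t * ep p i).
Proof.
rewrite /et /ep.
case: i => -[|[|[|//]]] /= ?; under eq_fun do rewrite !mxE /=; rewrite !mxE /=;
  (isd_by; ring).
Qed.

Lemma ep_dp t p i :
  is_derive p (1 : R) (fun p => ep p i) (- (sin t * er t p i + cos t * et t p i)).
Proof.
rewrite /er /et /ep.
case: i => -[|[|[|//]]] /= ?; under eq_fun do rewrite !mxE /=; rewrite !mxE /=;
  isd_by; ring: (cos2sin2 t).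
Qed.

Lemma frame_erer t p : \sum_i er t p i * er t p i = 1.
Proof. by expand_coords; ring: (cos2sin2 t) (cos2sin2 p). Qed.
Lemma frame_etet t p : \sum_i et t p i * et t p i = 1.
Proof. by expand_coords; ring: (cos2sin2 t) (cos2sin2 p). Qed.
Lemma frame_epep p : \sum_i ep p i * ep p i = 1.
Proof. by expand_coords; ring: (cos2sin2 p). Qed.
Lemma frame_eret t p : \sum_i er t p i * et t p i = 0.
Proof. by expand_coords; ring: (cos2sin2 t) (cos2sin2 p). Qed.
Lemma frame_erep t p : \sum_i er t p i * ep p i = 0.
Proof. by expand_coords; ring: (cos2sin2 t) (cos2sin2 p). Qed.
Lemma frame_etep t p : \sum_i et t p i * ep p i = 0.
Proof. by expand_coords; ring: (cos2sin2 t) (cos2sin2 p). Qed.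

Lemma frame_dot_er t p (x y z : R) :
  \sum_i er t p i * (x * er t p i + y * et t p i + z * ep p i) = x.
Proof.
transitivity (x * (\sum_i er t p i * er t p i) + y * (\sum_i er t p i * et t p i)
  + z * (\sum_i er t p i * ep p i)); first by rewrite !sum3; ring.
by rewrite frame_erer frame_eret frame_erep; ring.
Qed.

Lemma frame_dot_et t p (x y z : R) :
  \sum_i et t p i * (x * er t p i + y * et t p i + z * ep p i) = y.
Proof.
transitivity (x * (\sum_i er t p i * et t p i) + y * (\sum_i et t p i * et t p i)
  + z * (\sum_i et t p i * ep p i)); first by rewrite !sum3; ring.
by rewrite frame_etet frame_eret frame_etep; ring.
Qed.

Lemma frame_dot_ep t p (x y z : R) :
  \sum_i ep p i * (x * er t p i + y * et t p i + z * ep p i) = z.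
Proof.
transitivity (x * (\sum_i er t p i * ep p i) + y * (\sum_i et t p i * ep p i)
  + z * (\sum_i ep p i * ep p i)); first by rewrite !sum3; ring.
by rewrite frame_epep frame_erep frame_etep; ring.
Qed.

Lemma frame_expand t p (v : 'I_3 -> R) i :
  v i = (\sum_j er t p j * v j) * er t p i + (\sum_j et t p j * v j) * et t p i
        + (\sum_j ep p j * v j) * ep p i.
Proof.
expand_coords.
case: i => -[|[|[|//]]] /= hi;
  rewrite ?mxE /=.
- rewrite (_ : Ordinal hi = 0); last exact/val_inj.
  ring: (cos2sin2 t) (cos2sin2 p).
- rewrite (_ : Ordinal hi = 1); last exact/val_inj.
  ring: (cos2sin2 t) (cos2sin2 p).
- rewrite (_ : Ordinal hi = 2%:R); last exact/val_inj.
  ring: (cos2sin2 t) (cos2sin2 p).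
Qed.

(** An identity between vector fields may be checked, or used, coefficientwise
    in the frame. *)
Lemma frame_inj t p (x y z : R) :
  (forall i, x * er t p i + y * et t p i + z * ep p i = 0) ->
  [/\ x = 0, y = 0 & z = 0].
Proof.
move=> H; split.
- by rewrite -(frame_dot_er t p x y z) big1// => i _; rewrite H mulr0.
- by rewrite -(frame_dot_et t p x y z) big1// => i _; rewrite H mulr0.
- by rewrite -(frame_dot_ep t p x y z) big1// => i _; rewrite H mulr0.
Qed.

(** The chain rule in coordinates: through it every directional derivative
    becomes the derivative of a function of one real variable. *)
Lemma isd_curve (w : 'rV[R]_3 -> R) (c : R -> 'rV[R]_3) (dc : 'I_3 -> R) (t : R) :
  differentiable w (c t) ->
  (forall i, is_derive t (1 : R) (fun s => c s 0 i) (dc i)) ->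
  is_derive t (1 : R) (fun s => w (c s)) (\sum_i dc i * 'D_(unit_vec i) w (c t)).
Proof.
move=> wd cd.
have cder : derivable c t 1.
  by apply/derivable_mxP => a i; rewrite (ord1 a); case: (cd i).
have cdiff : differentiable c t by apply/derivable1_diffP.
have wc : differentiable (w \o c) t by apply: differentiable_comp.
apply: DeriveDef; first exact/derivable1_diffP.
rewrite deriveE // diff_comp //= -(deriveE (1 : R) cdiff) derive_mx //.
transitivity ('d w (c t) (\sum_i dc i *: unit_vec i)).
  congr ('d w (c t) _); apply/rowP => j; rewrite mxE summxE (bigD1 j) //= !mxE !eqxx mulr1.
  rewrite big1 ?addr0; first by have [_ <-] := cd j.
  by move=> i ij; rewrite !mxE eq_sym (negbTE ij) andbF mulr0.
rewrite linear_sum; apply: eq_bigr => i _; rewrite linearZ /= deriveE //.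
Qed.

End Frame.

(** * Points of the sphere and gradients of homogeneous functions *)

Section SphericalPoints.
Variable R : realType.
Implicit Types (t p r : R).

Lemma dot_sum3 (v w : 'rV[R]_3) :
  dot v w = v 0 0 * w 0 0 + v 0 1 * w 0 1 + v 0 2%:R * w 0 2%:R.
Proof. exact: sum3. Qed.

Lemma enorm_sph r t p : 0 < r -> enorm (sph r t p) = r.
Proof.
move=> r0; rewrite /enorm dot_sum3 !mxE /=.
have -> : r * (sin t * cos p) * (r * (sin t * cos p)) +
          r * (sin t * sin p) * (r * (sin t * sin p)) +
          r * cos t * (r * cos t) = r ^+ 2.
  by ring: (cos2sin2 t) (cos2sin2 p).
by rewrite sqrtr_sqr gtr0_norm.
Qed.

Lemma sph_neq_pole t p (a : R) : 0 < t < pi -> e_r t p <> vec3 0 0 a.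
Proof.
move=> /sin_gt0_pi st E.
have := congr1 (fun v : 'rV[R]_3 => v 0 0 ^+ 2 + v 0 1 ^+ 2) E; rewrite !mxE /=.
have -> : (sin t * cos p) ^+ 2 + (sin t * sin p) ^+ 2 = sin t ^+ 2.
  by ring: (cos2sin2 p).
rewrite expr0n /= addr0 => /eqP; rewrite expf_eq0 /= => /eqP s0.
by rewrite s0 ltxx in st.
Qed.

Lemma cone_sph r t p : 0 < r -> 0 < t < pi ->
  cone (sphere `\` [set south; north]) (sph r t p).
Proof.
move=> r0 tpi; split.
  apply/eqP => E; have := enorm_sph t p r0; rewrite E /enorm dot_sum3 !mxE.
  by rewrite !mulr0 !addr0 sqrtr0 => r00; rewrite -r00 ltxx in r0.
rewrite enorm_sph // /sph scalerA mulVf ?gt_eqF // scale1r; split.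
  by have := enorm_sph t p ltr01; rewrite /sph scale1r.
by case; apply: sph_neq_pole.
Qed.

(** In the orthonormal frame at a point, the radial component of the gradient
    is given by Euler's identity, and the other two are the derivatives of the
    restriction [W] to the sphere along the meridian and along the parallel,
    the latter divided by the radius [sin t] of the parallel. *)
Lemma gradient_sph (w : 'rV[R]_3 -> R) (W : R -> R -> R) k r t p (Wt Wp : R) :
  0 < r -> 0 < t < pi -> differentiable w (sph r t p) ->
  (forall r' t' p', 0 < r' -> 0 < t' < pi ->
     w (sph r' t' p') = r'^-1 ^+ k * W t' p') ->
  is_derive t (1 : R) (fun t' => W t' p) Wt ->
  is_derive p (1 : R) (fun p' => W t p') Wp ->
  forall i, 'D_(unit_vec i) w (sph r t p) =
    r^-1 ^+ k.+1 * (- k%:R * W t p * er t p i + Wt * et t p i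
                    + Wp / sin t * ep p i).
Proof.
move=> r0 tpi wd wW dWt dWp i.
have s0 := sin_gt0_pi tpi.
have rn0 : r != 0 by rewrite gt_eqF.
have sn0 : sin t != 0 by rewrite gt_eqF.
pose D i := 'D_(unit_vec i) w (sph r t p).
have Dr : \sum_j er t p j * D j = r^-1 ^+ k.+1 * (- k%:R * W t p).
  have H1 : is_derive r (1 : R) (fun s => w (sph s t p)) (\sum_j er t p j * D j).
    apply: (@isd_curve _ w (fun s => sph s t p)) => // j.
    under eq_fun do rewrite mxE; isd_by; rewrite /er; ring.
  have H2 : is_derive r (1 : R) (fun s => s^-1 ^+ k * W t p)
              (r^-1 ^+ k.+1 * (- k%:R * W t p)).
    isd_by => //; case: (k) => [|k']; first by rewrite /=; ring.
    by rewrite /= !exprS; field.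
  have H3 : is_derive r (1 : R) (fun s => w (sph s t p))
              (r^-1 ^+ k.+1 * (- k%:R * W t p)).
    apply: (@isd_ext _ (fun s => s^-1 ^+ k * W t p) _ 0 (r + 1)) H2.
      by rewrite r0 ltrDl ltr01.
    by move=> s /andP[s1 _]; rewrite wW.
  exact: isd_unique H1 H3.
have Dt : \sum_j et t p j * D j = r^-1 ^+ k.+1 * Wt.
  have H1 : is_derive t (1 : R) (fun s => w (sph r s p))
              (\sum_j (r * et t p j) * D j).
    apply: (@isd_curve _ w (fun s => sph r s p)) => // j.
    under eq_fun do rewrite mxE.
    isd_by; first exact: (er_dt t p j); by ring.
  have H3 : is_derive t (1 : R) (fun s => w (sph r s p)) (r^-1 ^+ k * Wt).
    apply: (@isd_ext _ (fun s => r^-1 ^+ k * W s p) _ 0 pi) => //.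
      by move=> s spi; rewrite wW.
  have := isd_unique H1 H3; under eq_bigr do rewrite -mulrA.
  rewrite -mulr_sumr => E; apply: (mulfI rn0); rewrite E exprS.
  by field.
have Dp : \sum_j ep p j * D j = r^-1 ^+ k.+1 * (Wp / sin t).
  have H1 : is_derive p (1 : R) (fun s => w (sph r t s))
              (\sum_j ((r * sin t) * ep p j) * D j).
    apply: (@isd_curve _ w (fun s => sph r t s)) => // j.
    under eq_fun do rewrite mxE.
    isd_by; first exact: (er_dp t p j); by ring.
  have H3 : is_derive p (1 : R) (fun s => w (sph r t s)) (r^-1 ^+ k * Wp).
    apply: (@isd_ext _ (fun s => r^-1 ^+ k * W t s) _ (p - 1) (p + 1)).
    - by rewrite ltrDl ltrBlDr ltrDl ltr01.
    - by move=> s spi; rewrite wW.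
  have := isd_unique H1 H3; under eq_bigr do rewrite -mulrA.
  rewrite -mulr_sumr => E.
  have rs0 : r * sin t != 0 by rewrite mulf_neq0.
  apply: (mulfI rs0); rewrite E exprS.
  by field; rewrite rn0 sn0.
rewrite -/(D i) (frame_expand t p D i) Dr Dt Dp; ring.
Qed.

Lemma frame_dot t p (a b c x y z : R) :
  \sum_i (a * er t p i + b * et t p i + c * ep p i) *
         (x * er t p i + y * et t p i + z * ep p i) = a * x + b * y + c * z.
Proof.
transitivity (a * (\sum_i er t p i * (x * er t p i + y * et t p i + z * ep p i))
  + b * (\sum_i et t p i * (x * er t p i + y * et t p i + z * ep p i))
  + c * (\sum_i ep p i * (x * er t p i + y * et t p i + z * ep p i))).
  by rewrite !sum3; ring.
by rewrite frame_dot_er frame_dot_et frame_dot_ep.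
Qed.

Lemma coord_differentiable (v : 'rV[R]_3 -> 'rV[R]_3) x j :
  differentiable v x -> differentiable (fun y => v y 0 j) x.
Proof.
by move=> vd; apply: (@differentiable_comp _ _ _ _ v (fun M : 'rV[R]_3 => M 0 j)) => //;
  exact: differentiable_coord.
Qed.

Lemma coord_derive (v : 'rV[R]_3 -> 'rV[R]_3) x e j :
  differentiable v x -> 'D_e (fun y => v y 0 j) x = ('D_e v x) 0 j.
Proof. by move=> vd; rewrite derive_mx ?mxE //; exact: diff_derivable. Qed.

End SphericalPoints.

(** * Reduction of the Navier-Stokes system to the polar angle *)

Section TwiceDerivable.
Variable R : realType.
Implicit Types (f g : R -> R) (t : R).

Definition twice_derivable f := forall t, 0 < t < pi ->
  derivable f t 1 /\ derivable (derive1 f) t 1.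

Lemma derivable_ext f g (u v x : R) : u < x < v ->
  (forall t, u < t < v -> f t = g t) -> derivable f x 1 -> derivable g x 1.
Proof. by move=> xuv fg /isdP /(isd_ext xuv fg) []. Qed.

Lemma twiceP f (df : R -> R) :
  (forall t, 0 < t < pi -> is_derive t (1 : R) f (df t)) ->
  (forall t, 0 < t < pi -> derivable df t 1) -> twice_derivable f.
Proof.
move=> H1 H2 t tpi; split; first by case: (H1 t tpi).
apply: (derivable_ext tpi _ (H2 t tpi)) => s spi.
by rewrite (isd_val (H1 s spi)).
Qed.

Lemma twiceD f g : twice_derivable f -> twice_derivable g ->
  twice_derivable (fun t => f t + g t).
Proof.
move=> Hf Hg; have df t : 0 < t < pi -> is_derive t (1 : R) f (derive1 f t).
  by move=> /Hf[/isdP].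
have dg t : 0 < t < pi -> is_derive t (1 : R) g (derive1 g t).
  by move=> /Hg[/isdP].
notypeclasses refine (twiceP (fun t tpi => isdD (df t tpi) (dg t tpi)) _) => t tpi.
have [_ /isdP f2] := Hf t tpi; have [_ /isdP g2] := Hg t tpi.
by have [] := isdD f2 g2.
Qed.

Lemma twiceM f g : twice_derivable f -> twice_derivable g ->
  twice_derivable (fun t => f t * g t).
Proof.
move=> Hf Hg.
have df t : 0 < t < pi -> is_derive t (1 : R) f (derive1 f t).
  by move=> /Hf[/isdP].
have dg t : 0 < t < pi -> is_derive t (1 : R) g (derive1 g t).
  by move=> /Hg[/isdP].
notypeclasses refine (twiceP (fun t tpi => isdM (df t tpi) (dg t tpi)) _) => t tpi.
have [_ /isdP f2] := Hf t tpi; have [_ /isdP g2] := Hg t tpi.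
by have [] := isdD (isdM f2 (dg t tpi)) (isdM (df t tpi) g2).
Qed.

Lemma twice_sum3 (F : 'I_3 -> R -> R) : (forall i, twice_derivable (F i)) ->
  twice_derivable (fun t => \sum_i F i t).
Proof.
move=> H; under eq_fun do rewrite sum3.
by apply: twiceD => //; apply: twiceD.
Qed.

Lemma twice_er i : twice_derivable (fun t => er t 0 i).
Proof.
apply: (@twiceP _ (fun t => et t 0 i)) => t _; first exact: er_dt.
by case: (et_dt t 0 i).
Qed.

Lemma twice_et i : twice_derivable (fun t => et t 0 i).
Proof.
apply: (@twiceP _ (fun t => - er t 0 i)) => t _; first exact: et_dt.
by apply: derivableN; case: (er_dt t 0 i).
Qed.

Lemma twice_cst (c : R) : twice_derivable (fun=> c).
Proof.
apply: (@twiceP _ (fun=> 0)) => t _.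
exact: derivable_cst.
Qed.

End TwiceDerivable.

Section Reduction.
Variable R : realType.
Local Notation Omega := (@sphere R `\` [set south; north]).
Variables (u : 'rV[R]_3 -> 'rV[R]_3) (p : 'rV[R]_3 -> R).
Hypothesis uC2 : C2_on (cone Omega) u.
Hypothesis uhom : homogeneous_on (cone Omega) 1 u.
Hypothesis uaxi : axisymmetric u.
Hypothesis pC1 : C1_on (cone Omega) p.
Hypothesis phom : homogeneous_on (cone Omega) 2 p.
Hypothesis uNS : stationary_NS (cone Omega) u p.

(* The components of [u] on the sphere; axisymmetry lets them be read at the
   meridian angle [0]. [G j] is the [j]-th Cartesian coordinate of [u]. *)
Let f t := comp_r u 1 t 0.
Let g t := comp_theta u 1 t 0.
Let h t := comp_phi u 1 t 0.
Let G j t q := f t * er t q j + g t * et t q j + h t * ep q j.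

Lemma u_sph1 t q j : 0 < t < pi -> u (sph 1 t q) 0 j = G j t q.
Proof.
move=> tpi; rewrite (frame_expand t q (u (sph 1 t q) 0) j) /G /f /g /h.
have [-> -> ->] := uaxi 0 q ltr01 tpi.
by congr (_ * _ + _ * _ + _ * _); apply: eq_bigr => i _; rewrite mulrC.
Qed.

Lemma u_sph r t q j : 0 < r -> 0 < t < pi ->
  u (sph r t q) 0 j = r^-1 ^+ 1 * G j t q.
Proof.
move=> r0 tpi; rewrite -u_sph1 //.
have := uhom (cone_sph q ltr01 tpi) r0.
rewrite /sph scalerA mulr1 expr1 => ->.
by rewrite mxE expr1 mulrA mulVf ?mul1r // gt_eqF.
Qed.

Lemma u_diff r t q : 0 < r -> 0 < t < pi -> differentiable u (sph r t q).
Proof. by move=> r0 tpi; have [] := uC2.1 _ (cone_sph q r0 tpi). Qed.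

Lemma du_diff r t q i : 0 < r -> 0 < t < pi ->
  differentiable ('D_(unit_vec i) u) (sph r t q).
Proof. by move=> r0 tpi; have [] := uC2.2 i _ (cone_sph q r0 tpi). Qed.

Lemma p_diff r t q : 0 < r -> 0 < t < pi -> differentiable p (sph r t q).
Proof. by move=> r0 tpi; have [] := pC1 (cone_sph q r0 tpi). Qed.

Lemma meridian_derive (w : 'rV[R]_3 -> R) t q :
  differentiable w (sph 1 t q) ->
  is_derive t (1 : R) (fun t => w (sph 1 t q))
    (\sum_i et t q i * 'D_(unit_vec i) w (sph 1 t q)).
Proof.
move=> wd; apply: (@isd_curve _ w (fun t => sph 1 t q)) => // i.
by under eq_fun do rewrite mxE mul1r; exact: er_dt.
Qed.

Lemma parallel_derive (w : 'rV[R]_3 -> R) t q :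
  differentiable w (sph 1 t q) ->
  is_derive q (1 : R) (fun q => w (sph 1 t q))
    (\sum_i sin t * ep q i * 'D_(unit_vec i) w (sph 1 t q)).
Proof.
move=> wd; apply: (@isd_curve _ w (fun q => sph 1 t q)) => // i.
by under eq_fun do rewrite mxE mul1r; exact: er_dp.
Qed.

(** The second derivative exists because the partial derivatives of [u] are
    themselves differentiable along the meridian. *)
Lemma twice_u j : twice_derivable (fun t => u (sph 1 t 0) 0 j).
Proof.
apply: (@twiceP _ _ (fun t =>
   \sum_i et t 0 i * ('D_(unit_vec i) u (sph 1 t 0)) 0 j)) => t tpi.
  apply: isd_eq.
    apply: (@meridian_derive (fun x => u x 0 j)).
    by apply: coord_differentiable; exact: u_diff.
  by apply: eq_bigr => i _; rewrite coord_derive //; exact: u_diff.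
under eq_fun do rewrite sum3.
have K i : derivable (fun t => et t 0 i * ('D_(unit_vec i) u (sph 1 t 0)) 0 j) t 1.
  apply: derivableM; first by case: (et_dt t 0 i).
  have := @meridian_derive (fun x => ('D_(unit_vec i) u x) 0 j) t 0 _; case=> //.
  by apply: coord_differentiable; exact: du_diff.
by apply: derivableD => //; apply: derivableD.
Qed.

Lemma twice_f : twice_derivable f.
Proof.
by apply: twice_sum3 => i; apply: twiceM; [exact: twice_u | exact: twice_er].
Qed.
Lemma twice_g : twice_derivable g.
Proof.
by apply: twice_sum3 => i; apply: twiceM; [exact: twice_u | exact: twice_et].
Qed.
Lemma twice_h : twice_derivable h.
Proof.
by apply: twice_sum3 => i; apply: twiceM; [exact: twice_u | exact: twice_cst].
Qed.

Let f' := derive1 f.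
Let g' := derive1 g.
Let h' := derive1 h.
Let f'' := derive1 f'.
Let g'' := derive1 g'.
Let h'' := derive1 h'.

(* The derivatives of [G j] in the polar angle (suffix [t]) and in the meridian
   angle (suffix [p]), developed in the frame. *)
Let Gt j t q := (f' t - g t) * er t q j + (f t + g' t) * et t q j + h' t * ep q j.
Let Gp j t q := - (h t * sin t) * er t q j + - (h t * cos t) * et t q j
  + (f t * sin t + g t * cos t) * ep q j.
Let Gtt j t q := (f'' t - 2 * g' t - f t) * er t q j
  + (2 * f' t + g'' t - g t) * et t q j + h'' t * ep q j.
Let Gpp j t q := - ((f t * sin t + g t * cos t) * sin t) * er t q j
  + - ((f t * sin t + g t * cos t) * cos t) * et t q j + - h t * ep q j.

Lemma fgh_derive t : 0 < t < pi ->
  [/\ is_derive t (1 : R) f (f' t), is_derive t (1 : R) g (g' t) &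
      is_derive t (1 : R) h (h' t)].
Proof.
by move=> tpi; split; apply: isdP; [have []:=twice_f tpi | have []:=twice_g tpi|
  have []:=twice_h tpi].
Qed.

Lemma fgh_derive2 t : 0 < t < pi ->
  [/\ is_derive t (1 : R) f' (f'' t), is_derive t (1 : R) g' (g'' t) &
      is_derive t (1 : R) h' (h'' t)].
Proof.
by move=> tpi; split; apply: isdP; [have []:=twice_f tpi | have []:=twice_g tpi|
  have []:=twice_h tpi].
Qed.

Lemma G_dt j t q : 0 < t < pi ->
  is_derive t (1 : R) (fun t => G j t q) (Gt j t q).
Proof.
move=> tpi; have [df dg dh] := fgh_derive tpi.
rewrite /G /Gt; isd_by; [exact: er_dt|exact: et_dt|]; ring.
Qed.

Lemma G_dp j t q : is_derive q (1 : R) (fun q => G j t q) (Gp j t q).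
Proof.
rewrite /G /Gp; isd_by; [exact: er_dp|exact: et_dp|exact: (ep_dp t)|]; ring.
Qed.

Lemma Gt_dt j t q : 0 < t < pi ->
  is_derive t (1 : R) (fun t => Gt j t q) (Gtt j t q).
Proof.
move=> tpi; have [df dg dh] := fgh_derive tpi.
have [ddf ddg ddh] := fgh_derive2 tpi.
rewrite /Gtt /Gt; isd_by; [exact: er_dt|exact: et_dt|]; ring.
Qed.

Lemma Gt_dp j t q : exists X, is_derive q (1 : R) (fun q => Gt j t q) X.
Proof.
by rewrite /Gt; eexists; isd; [exact: er_dp|exact: et_dp|exact: (ep_dp t)].
Qed.

Lemma Gp_dt j t q : 0 < t < pi ->
  exists X, is_derive t (1 : R) (fun t => Gp j t q / sin t) X.
Proof.
move=> tpi; have [df dg dh] := fgh_derive tpi.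
rewrite /Gp; eexists; isd; [exact: er_dt|exact: et_dt|].
by rewrite gt_eqF // sin_gt0_pi.
Qed.

Lemma Gp_dp j t q : is_derive q (1 : R) (fun q => Gp j t q) (Gpp j t q).
Proof.
rewrite /Gpp /Gp; isd_by; [exact: er_dp|exact: et_dp|exact: (ep_dp t)|].
by ring: (cos2sin2 t).
Qed.

(* On the sphere, the [i]-th partial derivative of the [j]-th coordinate. *)
Let M i j t q := - G j t q * er t q i + Gt j t q * et t q i
  + Gp j t q / sin t * ep q i.

Lemma du_sph r t q i j : 0 < r -> 0 < t < pi ->
  ('D_(unit_vec i) u (sph r t q)) 0 j = r^-1 ^+ 2 * M i j t q.
Proof.
move=> r0 tpi; rewrite -coord_derive; last exact: u_diff.
have ud : differentiable (fun x => u x 0 j) (sph r t q).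
  by apply: coord_differentiable; exact: u_diff.
rewrite (gradient_sph r0 tpi ud (fun r t q => @u_sph r t q j)
  (G_dt j q tpi) (G_dp j t q)).
by rewrite /M; ring.
Qed.

(** The second partial derivatives come from [gradient_sph] applied to the
    partial derivatives of [u], which are homogeneous of degree [-2]. *)
Lemma laplacian_sph t q j : 0 < t < pi ->
  (laplacian u (sph 1 t q)) 0 j =
  Gtt j t q + cos t / sin t * Gt j t q + Gpp j t q / sin t ^+ 2.
Proof.
move=> tpi; have s0 : sin t != 0 by rewrite gt_eqF // sin_gt0_pi.
have [X dX] := Gp_dt j q tpi.
have [Y dY] := Gt_dp j t q.
rewrite /laplacian summxE.
(* The sum over [i] is a contraction with the orthonormal frame: it keeps the
   coefficients [A] and [B] and drops the mixed ones, in particular [X] and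
   [Y]. *)
pose A := Gtt j t q - G j t q.
pose B := (Gt j t q * cos t + Gpp j t q / sin t - G j t q * sin t) / sin t.
transitivity (\sum_i (
   (1 * er t q i + 0 * et t q i + 0 * ep q i) *
   (2 * G j t q * er t q i + - 2 * Gt j t q * et t q i + - 2 * Gp j t q / sin t * ep q i) +
   (0 * er t q i + 1 * et t q i + 0 * ep q i) *
   (- 2 * Gt j t q * er t q i + A * et t q i + X * ep q i) +
   (0 * er t q i + 0 * et t q i + 1 * ep q i) *
   (- 2 * Gp j t q / sin t * er t q i + (Y - Gp j t q / sin t * cos t) / sin t * et t q i
     + B * ep q i))).
  apply: eq_bigr => i _; rewrite -coord_derive; last exact: du_diff.
  have dMt : is_derive t (1 : R) (fun t => M i j t q)
    (- 2 * Gt j t q * er t q i + A * et t q i + X * ep q i).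
    have dG := G_dt j q tpi; have dGt := Gt_dt j q tpi.
    pose Q s := Gp j s q / sin s; have dQ : is_derive t (1 : R) Q X := dX.
    change (is_derive t (1 : R) (fun s => - G j s q * er s q i
      + Gt j s q * et s q i + Q s * ep q i)
      (- 2 * Gt j t q * er t q i + A * et t q i + X * ep q i)).
    rewrite /A; isd_by; [exact: er_dt|exact: et_dt|]; ring.
  have dMp : is_derive q (1 : R) (fun q => M i j t q)
    ((- 2 * Gp j t q * er t q i + (Y - Gp j t q / sin t * cos t) * et t q i
     + B * sin t * ep q i)).
    have dG := G_dp j t q; have dGp := Gp_dp j t q.
    rewrite /M /B; isd_by; [exact: er_dp|exact: et_dp|exact: (ep_dp t)|].
    by field.
  have ud : differentiable (fun x => ('D_(unit_vec i) u x) 0 j) (sph 1 t q).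
    by apply: coord_differentiable; exact: du_diff.
  rewrite (gradient_sph ltr01 tpi ud (fun r t q => @du_sph r t q i j) dMt dMp).
  by rewrite /M invr1 expr1n; field.
rewrite !big_split /= !frame_dot /A /B; field.
by [].
Qed.

Lemma advection_sph t q j : 0 < t < pi ->
  (advection u (sph 1 t q)) 0 j =
  - f t * G j t q + g t * Gt j t q + h t * (Gp j t q / sin t).
Proof.
move=> tpi; rewrite /advection summxE.
under eq_bigr => i _.
  rewrite mxE u_sph1 // du_sph // invr1 expr1n mul1r /M /G.
  over.
rewrite frame_dot /G; ring.
Qed.

Lemma divergence_sph t : 0 < t < pi -> f t + g' t + g t * (cos t / sin t) = 0.
Proof.
move=> tpi; have s0 : sin t != 0 by rewrite gt_eqF // sin_gt0_pi.
have [_ +] := uNS (cone_sph 0 ltr01 tpi).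
rewrite /divergence => <-.
under eq_bigr => i _ do rewrite du_sph // invr1 expr1n mul1r.
transitivity (\sum_i ((1 * er t 0 i + 0 * et t 0 i + 0 * ep 0 i) *
  (- f t * er t 0 i + - g t * et t 0 i + - h t * ep 0 i) +
  (0 * er t 0 i + 1 * et t 0 i + 0 * ep 0 i) *
  ((f' t - g t) * er t 0 i + (f t + g' t) * et t 0 i + h' t * ep 0 i) +
  (0 * er t 0 i + 0 * et t 0 i + 1 * ep 0 i) *
  (- h t * er t 0 i + - (h t * cos t / sin t) * et t 0 i +
    (f t + g t * cos t / sin t) * ep 0 i))).
  by rewrite !big_split /= !frame_dot; field.
by apply: eq_bigr => i _; rewrite /M /G /Gt /Gp; field.
Qed.

Let P t q := p (sph 1 t q).

Lemma momentum_sph t q (Pt Pp : R) : 0 < t < pi ->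
  is_derive t (1 : R) (fun t => P t q) Pt ->
  is_derive q (1 : R) (fun q => P t q) Pp ->
  [/\ f'' t + cos t / sin t * f' t
      = g t * f' t - f t ^+ 2 - g t ^+ 2 - h t ^+ 2 - 2 * P t q,
      g'' t + 2 * f' t + cos t / sin t * g' t - g t / sin t ^+ 2
      = g t * g' t - h t ^+ 2 * (cos t / sin t) + Pt &
      h'' t + cos t / sin t * h' t - h t / sin t ^+ 2
      = g t * h' t + g t * h t * (cos t / sin t) + Pp / sin t].
Proof.
move=> tpi dPt dPp; have s0 : sin t != 0 by rewrite gt_eqF // sin_gt0_pi.
have dv := divergence_sph tpi.
have [mom _] := uNS (cone_sph q ltr01 tpi).
have pg i : gradient p (sph 1 t q) 0 i =
   - 2 * P t q * er t q i + Pt * et t q i + Pp / sin t * ep q i.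
  have pP r' t' q' : 0 < r' -> 0 < t' < pi ->
      p (sph r' t' q') = r'^-1 ^+ 2 * P t' q'.
    move=> r0 tpi'; have := phom (cone_sph q' ltr01 tpi') r0.
    rewrite /P {1 2}/sph scalerA mulr1 => ->.
    by rewrite /GRing.scale /= mulrA -exprMn mulVf ?expr1n ?mul1r // gt_eqF.
  rewrite mxE (gradient_sph ltr01 tpi (p_diff q ltr01 tpi) pP dPt dPp).
  by rewrite invr1 expr1n mul1r.
have E i : (- (f'' t - 2 * g' t - f t + cos t / sin t * (f' t - g t)
       - (f t * sin t + g t * cos t) / sin t)
     + (- f t ^+ 2 + g t * (f' t - g t) - h t ^+ 2) - 2 * P t q) * er t q i
  + (- (2 * f' t + g'' t - g t + cos t / sin t * (f t + g' t)
       - (f t * sin t + g t * cos t) * cos t / sin t ^+ 2)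
     + (- f t * g t + g t * (f t + g' t) - h t ^+ 2 * (cos t / sin t)) + Pt) * et t q i
  + (- (h'' t + cos t / sin t * h' t - h t / sin t ^+ 2)
     + (- f t * h t + g t * h' t + h t * (f t * sin t + g t * cos t) / sin t)
     + Pp / sin t) * ep q i = 0.
  have := congr1 (fun v : 'rV[R]_3 => v 0 i) mom.
  rewrite !mxE laplacian_sph // advection_sph // => H.
  rewrite -[RHS]H.
  have := pg i; rewrite mxE => ->.
  by rewrite /Gtt /Gt /Gpp /Gp /G; field.
have [E1 E2 E3] := frame_inj E.
have s2 : cos t ^+ 2 = 1 - sin t ^+ 2 by exact: cos2sin2.
split; apply/eqP; rewrite -subr_eq0; apply/eqP.
- have comb (a b c : R) : a = 0 -> b = 0 -> c = 2 * b - a -> c = 0.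
    by move=> -> -> ->; rewrite mulr0 subr0.
  by apply: (comb _ _ _ E1 dv); field.
- have comb (a c : R) : a = 0 -> c = - a -> c = 0 by move=> -> ->; rewrite oppr0.
  apply: (comb _ _ E2).
  by field: s2.
- have comb (a c : R) : a = 0 -> c = - a -> c = 0 by move=> -> ->; rewrite oppr0.
  by apply: (comb _ _ E3); field.
Qed.

Lemma pressure_dp t q : 0 < t < pi -> exists Pp, is_derive q (1 : R) (P t) Pp.
Proof. by move=> tpi; eexists; apply: parallel_derive; exact: p_diff. Qed.

Lemma pressure_dt t q : 0 < t < pi ->
  exists Pt, is_derive t (1 : R) (fun t => P t q) Pt.
Proof. by move=> tpi; eexists; apply: meridian_derive; exact: p_diff. Qed.

(** The [e_phi]-component of the momentum equation says that the derivative of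
    the pressure along a parallel is a constant [K]; the pressure takes the same
    value after a full turn, so [K = 0]. *)
Lemma pressure_axisym t q : 0 < t < pi -> is_derive q (1 : R) (P t) 0.
Proof.
move=> tpi; have s0 : sin t != 0 by rewrite gt_eqF // sin_gt0_pi.
pose K := sin t * (h'' t + cos t / sin t * h' t - h t / sin t ^+ 2
  - (g t * h' t + g t * h t * (cos t / sin t))).
have dP q' : is_derive q' (1 : R) (P t) K.
  have [Pp dPp] := pressure_dp q' tpi.
  have [Pt dPt] := pressure_dt q' tpi.
  have [_ _ E] := momentum_sph tpi dPt dPp.
  by apply: isd_eq dPp _; rewrite /K E; field.
have : P t (pi *+ 2) = P t 0.
  by rewrite /P /sph /e_r cos2pi sin2pi cos0 sin0.
have pi2 : (0 : R) < pi *+ 2 by rewrite pmulrn_lgt0 // pi_gt0.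
have Pc : {within `[0, pi *+ 2], continuous P t}.
  by apply: derivable_within_continuous => q' _; case: (dP q').
have [c _ +] := MVT pi2 (fun q' _ => dP q') Pc.
move=> + E; rewrite E subrr subr0 => /esym/eqP.
rewrite mulf_eq0 (gt_eqF pi2) orbF => /eqP K0.
by rewrite -K0.
Qed.

(** The three momentum equations are the coefficients of [e_r], [e_theta] and
    [e_phi]; their viscous terms are simplified with the divergence equation. *)
Lemma reduced_system : exists f g h P : R -> R,
  [/\ [/\ twice_derivable f, twice_derivable g & twice_derivable h],
      forall t q j, 0 < t < pi ->
        u (sph 1 t q) 0 j = f t * er t q j + g t * et t q j + h t * ep q j,
      forall t, 0 < t < pi -> f t + derive1 g t + g t * (cos t / sin t) = 0 &
      forall t, 0 < t < pi ->
      [/\ derive1 (derive1 f) t + cos t / sin t * derive1 f t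
          = g t * derive1 f t - f t ^+ 2 - g t ^+ 2 - h t ^+ 2 - 2 * P t,
          is_derive t (1 : R) P
            (derive1 (derive1 g) t + 2 * derive1 f t + cos t / sin t * derive1 g t
             - g t / sin t ^+ 2 - g t * derive1 g t + h t ^+ 2 * (cos t / sin t)) &
          derive1 (derive1 h) t + cos t / sin t * derive1 h t - h t / sin t ^+ 2
          = g t * derive1 h t + g t * h t * (cos t / sin t)]].
Proof.
exists f, g, h, (fun t => P t 0); split.
- by split; [exact: twice_f | exact: twice_g | exact: twice_h].
- by move=> t q j tpi; exact: u_sph1.
- exact: divergence_sph.
- move=> t tpi; have [Pt dPt] := pressure_dt 0 tpi.
  have [E1 E2 E3] := momentum_sph tpi dPt (pressure_axisym 0 tpi).
  split; first exact: E1.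
    by apply: isd_eq dPt _; rewrite -/f' -/g' -/g'' E2; ring.
  by rewrite -/h' -/h'' E3 mul0r addr0.
Qed.

End Reduction.

(** * Mean value arguments, first-order linear equations, logarithms *)

Section RealLemmas.
Variable R : realType.
Implicit Types (f g k : R -> R) (a b x y t : R).

Lemma mvt_closed f (df : R -> R) a b : a < b ->
  (forall x, a <= x <= b -> is_derive x (1 : R) f (df x)) ->
  exists2 c, a < c < b & f b - f a = df c * (b - a).
Proof.
move=> ab fd.
have fo x : x \in `]a, b[ -> is_derive x (1 : R) f (df x).
  by move=> /itvP xab; apply: fd; rewrite !xab.
have fc : {within `[a, b], continuous f}.
  apply: derivable_within_continuous => x; rewrite in_itv /= => xab.
  by case: (fd x xab).
by have [c] := MVT ab fo fc; rewrite in_itv /= => cab E; exists c.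
Qed.

Lemma zero_derive_const f a b x y : a < x < b -> a < y < b ->
  (forall t, a < t < b -> is_derive t (1 : R) f 0) -> f x = f y.
Proof.
move=> + + fd; wlog xy : x y / x < y.
  move=> H xab yab; have [xy|yx|->//] := ltgtP x y; first exact: H.
  by apply/esym/H.
move=> /andP[ax xb] /andP[ay yb].
have fd' t : x <= t <= y -> is_derive t (1 : R) f 0.
  by move=> /andP[xt ty]; apply: fd; rewrite (lt_le_trans ax xt) (le_lt_trans ty yb).
have [z _] := mvt_closed xy fd'.
by rewrite mul0r => /eqP; rewrite subr_eq0 => /eqP.
Qed.

Lemma bounded_segment f a b : a <= b ->
  (forall x, a <= x <= b -> {for x, continuous f}) ->
  exists M, forall x, a <= x <= b -> `|f x| <= M.
Proof.
move=> ab fc.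
have fc' : {within `[a, b], continuous (fun x => `|f x|)}.
  apply: continuous_in_subspaceT => x; rewrite inE /= in_itv /= => xab.
  by apply: continuous_comp; [exact: fc | exact: norm_continuous].
have [c _ cmax] := EVT_max ab fc'.
by exists `|f c| => x xab; apply: cmax; rewrite in_itv.
Qed.

(** On a segment between [t0] and [t] the coefficient [g] is bounded, and the
    weight [exp (M x)] with [|M|] twice the bound makes [k ^ 2] monotone, in the
    direction that forces it to be nonpositive at [t]. *)
Lemma linear_ode_zero g k a b t0 t : a < t0 < b -> a < t < b ->
  (forall x, a < x < b -> {for x, continuous g}) ->
  (forall x, a < x < b -> is_derive x (1 : R) k (g x * k x)) ->
  k t0 = 0 -> k t = 0.
Proof.
move=> /andP[at0 t0b] /andP[at1 tb] gc kd k0.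
have E M : forall x, a < x < b -> is_derive x (1 : R)
    (fun x => k x ^+ 2 * expR (M * x)) ((2 * g x + M) * k x ^+ 2 * expR (M * x)).
  move=> x xab; have kx := kd x xab.
  have de : is_derive x (1 : R) (fun x => expR (M * x)) (expR (M * x) * M).
    by isd_by; ring.
  by isd_by; ring.
have key M : k t ^+ 2 * expR (M * t) <= k t0 ^+ 2 * expR (M * t0) -> k t = 0.
  rewrite k0 expr0n /= mul0r pmulr_lle0 ?expR_gt0 // => k2.
  by apply/eqP; rewrite -sqrf_eq0 eq_le k2 sqr_ge0.
have [tt0|t0t|->//] := ltgtP t t0.
- have [M HM] : exists M, forall x, t <= x <= t0 -> `|g x| <= M.
    apply: bounded_segment => [|x /andP[x1 x2]]; first exact: ltW.
    by apply: gc; rewrite (lt_le_trans at1 x1) (le_lt_trans x2 t0b).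
  apply: (key (2 * M)).
  have E' x (xab : t <= x <= t0) := E (2 * M) x
    (let: conj x1 x2 := andP xab in
     introT andP (conj (lt_le_trans at1 x1) (le_lt_trans x2 t0b))).
  have [c /andP[c1 c2] Ec] := mvt_closed tt0 E'.
  rewrite -subr_ge0 Ec; apply: mulr_ge0; last by rewrite subr_ge0 ltW.
  rewrite mulr_ge0 ?expR_ge0 // mulr_ge0 ?sqr_ge0 //.
  have /HM : t <= c <= t0 by rewrite !ltW.
  by rewrite ler_norml => /andP[]; lra.
- have [M HM] : exists M, forall x, t0 <= x <= t -> `|g x| <= M.
    apply: bounded_segment => [|x /andP[x1 x2]]; first exact: ltW.
    by apply: gc; rewrite (lt_le_trans at0 x1) (le_lt_trans x2 tb).
  apply: (key (- 2 * M)).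
  have E' x (xab : t0 <= x <= t) := E (- 2 * M) x
    (let: conj x1 x2 := andP xab in
     introT andP (conj (lt_le_trans at0 x1) (le_lt_trans x2 tb))).
  have [c /andP[c1 c2] Ec] := mvt_closed t0t E'.
  rewrite -subr_le0 Ec; apply: mulr_le0_ge0; last by rewrite subr_ge0 ltW.
  rewrite mulr_le0_ge0 ?expR_ge0 // mulr_le0_ge0 ?sqr_ge0 //.
  have /HM : t0 <= c <= t by rewrite !ltW.
  by rewrite ler_norml => /andP[]; lra.
Qed.

(** From [ln r < r] at [r = x ^ (-1/2)]. *)
Lemma mul_ln_bound x : 0 < x <= 1 -> x * `|ln x| <= 2 * Num.sqrt x.
Proof.
move=> /andP[x0 x1].
have s0 : 0 < Num.sqrt x by rewrite sqrtr_gt0.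
have xE : Num.sqrt x ^+ 2 = x by rewrite sqr_sqrtr // ltW.
have lx : ln x = 2 * ln (Num.sqrt x).
  by rewrite -{1}xE lnXn // mulr2n; ring.
rewrite ler0_norm ?ln_le0 // lx.
have : ln (Num.sqrt x)^-1 < (Num.sqrt x)^-1 by rewrite ln_sublinear // invr_gt0.
rewrite lnV ?posrE // => H.
rewrite -{1}xE.
have H2 : Num.sqrt x * - ln (Num.sqrt x) <= 1.
  by rewrite -ler_pdivlMl // mulr1 ltW.
have := ler_wpM2l (ltW s0) H2.
by nra.
Qed.

End RealLemmas.

(** * Vanishing of the swirl *)

Section PolarOde.
Variable R : realType.
Implicit Types (f g h P : R -> R) (t : R).

Lemma isd_continuous f t (a : R) : is_derive t (1 : R) f a -> {for t, continuous f}.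
Proof. by case=> fd _; apply: differentiable_continuous; apply/derivable1_diffP. Qed.

Lemma cvg0_le_sqrt T (F : set_system T) {FF : Filter F} (S w : T -> R) (C : R) :
  S x @[x --> F] --> (0 : R) -> (\forall x \near F, `|w x| <= C * Num.sqrt (S x)) ->
  w x @[x --> F] --> (0 : R).
Proof.
move=> S0 wS; apply: norm_cvg0.
apply: (@squeeze_cvgr _ _ _ _ (fun=> 0) (fun x => C * Num.sqrt (S x))).
- by apply: filterS wS => x ->; rewrite normr_ge0.
- exact: cvg_cst.
- rewrite -(mulr0 C); apply: cvgM; first exact: cvg_cst.
  rewrite -[X in _ --> X](sqrtr0 R).
  by apply: cvg_comp S0 _; exact: sqrt_continuous.
Qed.

Lemma sin_cvg0 : sin t @[t --> (0 : R)^'+] --> (0 : R).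
Proof.
rewrite -[X in _ --> X](@sin0 R); apply: cvg_at_right_filter.
exact: continuous_sin.
Qed.

Lemma sin_cvgpi : sin t @[t --> (pi : R)^'-] --> (0 : R).
Proof.
rewrite -[X in _ --> X](@sinpi R); apply: cvg_at_left_filter.
exact: continuous_sin.
Qed.

Lemma near_pole0 (d : R) : 0 < d ->
  \forall t \near (0 : R)^'+, 0 < t < pi /\ sin t < d.
Proof.
move=> d0; near=> t; split.
  by apply/andP; split; near: t; [exact: nbhs_right_gt | exact/nbhs_right_lt/pi_gt0].
have : `|sin t| < d by near: t; apply: cvgr0_norm_lt d0; exact: sin_cvg0.
by apply: le_lt_trans; exact: ler_norm.
Unshelve. all: by end_near. Qed.

Lemma near_polepi (d : R) : 0 < d ->
  \forall t \near (pi : R)^'-, 0 < t < pi /\ sin t < d.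
Proof.
move=> d0; near=> t; split.
  by apply/andP; split; near: t; [exact/nbhs_left_gt/pi_gt0 | exact: nbhs_left_lt].
have : `|sin t| < d by near: t; apply: cvgr0_norm_lt d0; exact: sin_cvgpi.
by apply: le_lt_trans; exact: ler_norm.
Unshelve. all: by end_near. Qed.

Lemma log_times_sin (w : R -> R) (M d : R) t : d <= 1 -> 0 <= M ->
  0 < t < pi -> sin t < d -> `|w t| <= M * `|ln (sin t)| ->
  `|w t * sin t| <= (M * 2) * Num.sqrt (sin t).
Proof.
move=> d1 M0 tpi sd wb; rewrite normrM (gtr0_norm (sin_gt0_pi tpi)).
have s1 : 0 < sin t <= 1 by rewrite sin_gt0_pi //= (le_trans (ltW sd)).
have := ler_wpM2l M0 (mul_ln_bound s1).
rewrite -mulrA; apply: le_trans.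
rewrite mulrCA mulrC; apply: ler_wpM2l wb.
by rewrite ltW // sin_gt0_pi.
Qed.

Lemma log_times_sin_cvg (w : R -> R) (M d : R) : 0 < d <= 1 -> 0 <= M ->
  (forall t, 0 < t < pi -> sin t < d -> `|w t| <= M * `|ln (sin t)|) ->
  w t * sin t @[t --> (0 : R)^'+] --> (0 : R) /\
  w t * sin t @[t --> (pi : R)^'-] --> (0 : R).
Proof.
move=> /andP[d0 d1] M0 wb; split.
- apply: (cvg0_le_sqrt (C := M * 2) sin_cvg0).
  apply: filterS (near_pole0 d0) => t [t1 t2].
  exact: (log_times_sin d1 M0 t1 t2 (wb t t1 t2)).
- apply: (cvg0_le_sqrt (C := M * 2) sin_cvgpi).
  apply: filterS (near_polepi d0) => t [t1 t2].
  exact: (log_times_sin d1 M0 t1 t2 (wb t t1 t2)).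
Qed.

(** [h sin theta] vanishes at both poles, so by Rolle's theorem its derivative
    vanishes somewhere; that derivative over [sin theta] solves a homogeneous
    linear equation of first order. *)
Lemma swirl_vanishes g h (M d : R) : 0 < d <= 1 -> 0 <= M ->
  (forall t, 0 < t < pi -> {for t, continuous g}) -> twice_derivable h ->
  (forall t, 0 < t < pi ->
     derive1 (derive1 h) t + cos t / sin t * derive1 h t - h t / sin t ^+ 2
     = g t * derive1 h t + g t * h t * (cos t / sin t)) ->
  (forall t, 0 < t < pi -> sin t < d -> `|h t| <= M * `|ln (sin t)|) ->
  forall t, 0 < t < pi -> h t = 0.
Proof.
move=> d01 M0 gc hh hE hb t0 t0pi.
pose W t := h t * sin t.
pose k t := derive1 h t + h t * (cos t / sin t).
have dh t : 0 < t < pi -> is_derive t (1 : R) h (derive1 h t).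
  by move=> /hh[/isdP].
have ddh t : 0 < t < pi -> is_derive t (1 : R) (derive1 h) (derive1 (derive1 h) t).
  by move=> /hh[_ /isdP].
have s0 t : 0 < t < pi -> sin t != 0 by move=> /sin_gt0_pi/gt_eqF ->.
have dW t : 0 < t < pi -> is_derive t (1 : R) W (sin t * k t).
  move=> tpi; have dht := dh _ tpi; rewrite /W; isd_by.
  by rewrite /k; field; exact: s0.
have dk t : 0 < t < pi -> is_derive t (1 : R) k (g t * k t).
  move=> tpi; have dht := dh _ tpi; have ddht := ddh _ tpi.
  rewrite /k; isd_by.
  have H : derive1 (derive1 h) t = - (cos t / sin t * derive1 h t) + h t / sin t ^+ 2
     + (g t * derive1 h t + g t * h t * (cos t / sin t)).
    by rewrite -(hE t tpi); ring.
  by rewrite H; field: (cos2sin2 t); exact: s0.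
have [W0 Wpi] := log_times_sin_cvg d01 M0 hb.
have Wc : {within `[0, pi], continuous W}.
  apply/continuous_within_itvP; first exact: pi_gt0.
  split.
  - by move=> t; rewrite in_itv /= => /dW /isd_continuous.
  - by rewrite {2}/W sin0 mulr0.
  - by rewrite {2}/W sinpi mulr0.
have Wd t : t \in `]0, pi[ -> derivable W t 1.
  by rewrite in_itv /= => /dW[].
have W0pi : W 0 = W pi by rewrite /W sin0 sinpi !mulr0.
have [c + Wc0] := Rolle (pi_gt0 R) Wd Wc W0pi.
rewrite in_itv /= => cpi.
have kc : k c = 0.
  have := isd_unique (dW _ cpi) Wc0 => /eqP; rewrite mulf_eq0 (negbTE (s0 _ cpi)) /=.
  by move/eqP.
have k0 t : 0 < t < pi -> k t = 0.
  by move=> tpi; exact: (linear_ode_zero cpi tpi gc dk kc).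
have dW0 t : 0 < t < pi -> is_derive t (1 : R) W 0.
  by move=> tpi; apply: isd_eq (dW _ tpi) _; rewrite k0 // mulr0.
have [t00 t0pi'] := andP t0pi.
have Wc' : {within `[0, t0], continuous W}.
  apply: continuous_subspaceW Wc => x; rewrite /= !in_itv /= => /andP[-> xt0] /=.
  by rewrite (le_trans xt0) // ltW.
have dW0' t : t \in `]0, t0[ -> is_derive t (1 : R) W 0.
  rewrite in_itv /= => /andP[tt0 tt1]; apply: dW0.
  by rewrite tt0 (lt_trans tt1 t0pi').
have [x _] := MVT t00 dW0' Wc'.
rewrite mul0r /W sin0 mulr0 subr0 => /eqP; rewrite mulf_eq0 (negbTE (s0 _ t0pi)) orbF.
by move/eqP.
Qed.

End PolarOde.

(** * The first integral and the passage to [y = cos theta] *)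

Section FirstIntegral.
Variable R : realType.
Implicit Types (f g P U : R -> R) (t y : R).

Lemma pihalf_itv : 0 < (pi : R) / 2 < pi.
Proof. by rewrite divr_gt0 ?pi_gt0 //= ltr_pdivrMr // ltr_pMr ?pi_gt0 // ltr1n. Qed.

(** The divergence equation turns the [e_theta]-equation into
    [P' = (f - g ^ 2 / 2)'], so [P] can be eliminated up to the constant [c3].
    If [E] is the left-hand side of the conclusion and [y = cos theta], then
    [dE/dy] is [sin theta] times [- f' + 2 g + g f], and the radial equation
    says that [d^2 E / dy^2 = - 2 c3]. *)
Lemma first_integral f g P : twice_derivable f -> twice_derivable g ->
  (forall t, 0 < t < pi -> f t + derive1 g t + g t * (cos t / sin t) = 0) ->
  (forall t, 0 < t < pi ->
     derive1 (derive1 f) t + cos t / sin t * derive1 f t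
     = g t * derive1 f t - f t ^+ 2 - g t ^+ 2 - 2 * P t) ->
  (forall t, 0 < t < pi -> is_derive t (1 : R) P
     (derive1 (derive1 g) t + 2 * derive1 f t + cos t / sin t * derive1 g t
      - g t / sin t ^+ 2 - g t * derive1 g t)) ->
  exists a b c3 : R, forall t, 0 < t < pi ->
    sin t ^+ 2 * f t + 2 * cos t * (g t * sin t) + 2^-1 * (g t * sin t) ^+ 2
    = a + b * cos t + c3 * sin t ^+ 2.
Proof.
move=> hf hg dv rE dP.
have s0 t : 0 < t < pi -> sin t != 0 by move=> /sin_gt0_pi/gt_eqF ->.
have df t : 0 < t < pi -> is_derive t (1 : R) f (derive1 f t).
  by move=> /hf[/isdP].
have ddf t : 0 < t < pi -> is_derive t (1 : R) (derive1 f) (derive1 (derive1 f) t).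
  by move=> /hf[_ /isdP].
have dg t : 0 < t < pi -> is_derive t (1 : R) g (derive1 g t).
  by move=> /hg[/isdP].
have ddg t : 0 < t < pi -> is_derive t (1 : R) (derive1 g) (derive1 (derive1 g) t).
  by move=> /hg[_ /isdP].
have g1E t : 0 < t < pi -> derive1 g t = - f t - g t * (cos t / sin t).
  by move=> /dv H; rewrite -[LHS]subr0 -H; ring.
have g2E t : 0 < t < pi -> derive1 (derive1 g) t =
    - derive1 f t - derive1 g t * (cos t / sin t) + g t / sin t ^+ 2.
  move=> tpi; have dft := df _ tpi; have dgt := dg _ tpi.
  apply: (isd_unique (ddg _ tpi)).
  apply: (isd_ext (f := fun t => - f t - g t * (cos t / sin t)) tpi).
    by move=> s spi; rewrite g1E.
  isd_by; field: (cos2sin2 t); exact: s0.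
have PE t : 0 < t < pi -> P t = f t - 2^-1 * g t ^+ 2
    + (P (pi / 2) - f (pi / 2) + 2^-1 * g (pi / 2) ^+ 2).
  move=> tpi.
  have H : P t - f t + 2^-1 * g t ^+ 2
      = P (pi / 2) - f (pi / 2) + 2^-1 * g (pi / 2) ^+ 2.
    apply: (zero_derive_const (f := fun t => P t - f t + 2^-1 * g t ^+ 2) tpi pihalf_itv).
    move=> s spi; have dft := df _ spi; have dgt := dg _ spi; have dPt := dP _ spi.
    isd_by; rewrite g2E // /=; field; exact: s0.
  by rewrite -H; ring.
set c3 := P _ - _ + _ in PE.
pose K t := sin t * (- derive1 f t + 2 * g t + g t * f t) + 2 * c3 * cos t.
have KE t : 0 < t < pi -> K t = K (pi / 2).
  move=> tpi; apply: (zero_derive_const tpi pihalf_itv) => s spi.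
  have dfs := df _ spi; have dgs := dg _ spi; have ddfs := ddf _ spi.
  have E : derive1 (derive1 f) s = - (cos s / sin s * derive1 f s)
     + (g s * derive1 f s - f s ^+ 2 - g s ^+ 2 - 2 * P s).
    by rewrite -rE //; ring.
  rewrite /K; isd_by; rewrite E PE // g1E //; field; exact: s0.
set b := K (pi / 2) in KE.
pose L t := sin t ^+ 2 * f t + 2 * cos t * (g t * sin t) + 2^-1 * (g t * sin t) ^+ 2
  - b * cos t - c3 * sin t ^+ 2.
have LE t : 0 < t < pi -> L t = L (pi / 2).
  move=> tpi; apply: (zero_derive_const tpi pihalf_itv) => s spi.
  have dfs := df _ spi; have dgs := dg _ spi.
  rewrite /L; isd_by; rewrite -(KE s) // /K g1E //; field: (cos2sin2 s); exact: s0.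
exists (L (pi / 2)), b, c3 => t tpi.
by rewrite -(LE t) // /L; ring.
Qed.

(** The distance to the axis of a point of height [y] on the unit sphere. *)
Definition axis_dist (y : R) : R := Num.sqrt (1 - y ^+ 2).

(** In the variable [y = cos theta], [U = g sin theta] is the stream function
    of the meridian flow: the divergence equation says [U' = f]. *)
Definition of_polar (g : R -> R) (y : R) : R := g (acos y) * axis_dist y.

Lemma sqr_lt1 y : -1 < y < 1 -> 0 < 1 - y ^+ 2.
Proof. by move=> /andP[y1 y2]; nra. Qed.

Lemma acos_itv y : -1 < y < 1 -> 0 < acos y < pi.
Proof. by move=> /andP[y1 y2]; rewrite acos_gt0 ?acos_ltpi ?y1 ?y2 //= ltW. Qed.

Lemma cos_acos y : -1 < y < 1 -> cos (acos y) = y.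
Proof. by move=> /andP[y1 y2]; rewrite acosK // in_itv /= !ltW. Qed.

Lemma sin_acos_itv y : -1 < y < 1 -> sin (acos y) = axis_dist y.
Proof. by move=> /andP[y1 y2]; rewrite sin_acos // !ltW. Qed.

Lemma of_polar_derive f g y :
  (forall t, 0 < t < pi -> is_derive t (1 : R) g (derive1 g t)) ->
  (forall t, 0 < t < pi -> f t + derive1 g t + g t * (cos t / sin t) = 0) ->
  -1 < y < 1 -> is_derive y (1 : R) (of_polar g) (f (acos y)).
Proof.
move=> dg dv y1; have tpi := acos_itv y1.
have sE := sin_acos_itv y1; have cE := cos_acos y1.
have st0 := sin_gt0_pi tpi.
have dgt := dg _ tpi.
have da : is_derive y (1 : R) (@acos R) (- (sin (acos y))^-1).
  by rewrite sE; exact: is_derive1_acos.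
have dW : is_derive (acos y) (1 : R) (fun t => g t * sin t)
    (- sin (acos y) * f (acos y)).
  isd_by; have := dv _ tpi => H.
  have -> : derive1 g (acos y) = - f (acos y) - g (acos y) * (cos (acos y) / sin (acos y)).
    by rewrite -[LHS]subr0 -H; ring.
  by field; rewrite gt_eqF.
have H := isd_comp da dW.
apply: (isd_ext (f := fun y => g (acos y) * sin (acos y)) y1).
  by move=> s s1; rewrite /of_polar sin_acos_itv.
by apply: isd_eq H _; field; rewrite gt_eqF.
Qed.

End FirstIntegral.

(** * The Riccati equation on [[-1, 1]] *)

Section Smoothness.
Variable R : realType.
Implicit Types (f g w U : R -> R) (y : R).

Fixpoint smooth n f : Prop :=
  if n is n'.+1 then
    (forall y, -1 < y < 1 -> derivable f y 1) /\ smooth n' (derive1 f)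
  else True.

Lemma smooth_derive1n n f y : -1 < y < 1 -> smooth n.+1 f ->
  derivable (derive1n n f) y 1.
Proof.
move=> y1; elim: n f => [|n IH] f; first by case=> /(_ y y1).
by case=> _ /IH; rewrite derive1Sn.
Qed.

Lemma smooth_ext n f g : (forall y, -1 < y < 1 -> f y = g y) ->
  smooth n f -> smooth n g.
Proof.
elim: n f g => [//|n IH] f g fg [df sf]; split.
  by move=> y y1; exact: derivable_ext y1 fg (df y y1).
apply: IH sf => y y1; apply/esym/isd_val.
by apply: (isd_ext y1 fg); exact: isdP (df y y1).
Qed.

Lemma smoothW n f : smooth n.+1 f -> smooth n f.
Proof. by elim: n f => [//|n IH] f [df /IH sf]. Qed.

Lemma smooth_succ n f (df : R -> R) :
  (forall y, -1 < y < 1 -> is_derive y (1 : R) f (df y)) ->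
  smooth n df -> smooth n.+1 f.
Proof.
move=> H sdf; split; first by move=> y /H[].
by apply: smooth_ext sdf => y /H /isd_val.
Qed.

Lemma smooth_derive n f y : -1 < y < 1 -> smooth n.+1 f ->
  is_derive y (1 : R) f (derive1 f y).
Proof. by move=> y1 [/(_ y y1) /isdP]. Qed.

Lemma smooth_cst n (c : R) : smooth n (fun=> c).
Proof.
elim: n c => [//|n IH] c; apply: smooth_succ (IH 0) => y _; exact: isd_cst.
Qed.

Lemma smooth_id n : smooth n (fun y => y).
Proof.
case: n => [//|n]; apply: smooth_succ (smooth_cst n 1) => y _; exact: isd_id.
Qed.

Lemma smoothD n f g : smooth n f -> smooth n g -> smooth n (fun y => f y + g y).
Proof.
elim: n f g => [//|n IH] f g sf sg.
have := @smooth_succ n (fun y => f y + g y) (fun y => derive1 f y + derive1 g y).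
apply.
  move=> y y1; have df := smooth_derive y1 sf; have dg := smooth_derive y1 sg.
  by isd.
by apply: IH; [case: sf | case: sg].
Qed.

Lemma smoothM n f g : smooth n f -> smooth n g -> smooth n (fun y => f y * g y).
Proof.
elim: n f g => [//|n IH] f g sf sg.
have := @smooth_succ n (fun y => f y * g y) (fun y => derive1 f y * g y + f y * derive1 g y).
apply.
  move=> y y1; have df := smooth_derive y1 sf; have dg := smooth_derive y1 sg.
  by isd.
by apply: smoothD; apply: IH; solve [exact: smoothW | by case: sf | by case: sg].
Qed.

Lemma smooth_inv n : smooth n (fun y => (1 - y ^+ 2)^-1).
Proof.
elim: n => [//|n IH].
apply: (smooth_succ (df := fun y =>
   2 * (y * ((1 - y ^+ 2)^-1 * (1 - y ^+ 2)^-1)))).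
  move=> y /sqr_lt1 y0; have yn0 : 1 - y ^+ 2 != 0 by rewrite gt_eqF.
  by isd_by; rewrite /=; field.
apply: smoothM; first exact: smooth_cst.
by apply: smoothM; [exact: smooth_id | exact: smoothM].
Qed.

(** Solutions are smooth by bootstrapping: the equation expresses [U'] by [U]
    and smooth functions. *)
Lemma riccati_smooth (c1 c2 c3 : R) U n :
  (forall y, -1 < y < 1 -> derivable U y 1) ->
  (forall y, -1 < y < 1 ->
     (1 - y ^+ 2) * derive1 U y + 2 * y * U y + 2^-1 * U y ^+ 2
     = c1 * (1 - y) + c2 * (1 + y) + c3 * (1 - y ^+ 2)) ->
  smooth n U.
Proof.
move=> dU UE; elim: n => [//|n IH].
apply: (smooth_succ (df := fun y => (c1 + c2 + c3 + (c2 - c1) * y + - c3 * (y * y)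
   + - 2 * (y * U y) + - 2^-1 * (U y * U y)) * (1 - y ^+ 2)^-1)).
  move=> y y1; apply: isd_eq (isdP (dU y y1)) _.
  have y0 := sqr_lt1 y1; have yn0 : 1 - y ^+ 2 != 0 by rewrite gt_eqF.
  apply: (mulfI yn0).
  have -> : (1 - y ^+ 2) * derive1 U y = c1 * (1 - y) + c2 * (1 + y)
     + c3 * (1 - y ^+ 2) - 2 * y * U y - 2^-1 * U y ^+ 2.
    by rewrite -(UE y y1); ring.
  by field.
apply: smoothM; last exact: smooth_inv.
have sy := smooth_id n; have sc := smooth_cst n.
by repeat (first [exact: sc | exact: sy | exact: IH | apply: smoothD | apply: smoothM]).
Qed.

End Smoothness.

Section Riccati.
Variable R : realType.
Implicit Types (U V : R -> R) (y : R).

Lemma Utheta_derive c1 c2 c3 U y : Utheta_ode c1 c2 c3 U -> -1 < y < 1 ->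
  is_derive y (1 : R) U (derive1 U y).
Proof. by case=> sU _ _ y1; exact/isdP/(sU 0%N). Qed.

Lemma Utheta_derive1E c1 c2 c3 U y : Utheta_ode c1 c2 c3 U -> -1 < y < 1 ->
  derive1 U y = (c1 * (1 - y) + c2 * (1 + y) + c3 * (1 - y ^+ 2)
     - 2 * y * U y - 2^-1 * U y ^+ 2) / (1 - y ^+ 2).
Proof.
case=> _ _ UE y1; have y0 := sqr_lt1 y1; have yn0 : 1 - y ^+ 2 != 0 by rewrite gt_eqF.
by rewrite -(UE y y1); field.
Qed.

Lemma cvg_left1 : y @[y --> (1 : R)^'-] --> (1 : R).
Proof. by apply: cvg_at_left_filter; exact: cvg_id. Qed.

Lemma cvg_rightN1 : y @[y --> (-1 : R)^'+] --> (-1 : R).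
Proof. by apply: cvg_at_right_filter; exact: cvg_id. Qed.

Lemma within_cvg1 U : {within `[-1, 1], continuous U} -> U y @[y --> (1:R)^'-] --> U 1.
Proof. by case/(continuous_within_itvP _ (gtrN ltr01)). Qed.

Lemma within_cvgN1 U : {within `[-1, 1], continuous U} ->
  U y @[y --> (-1:R)^'+] --> U (-1).
Proof. by case/(continuous_within_itvP _ (gtrN ltr01)). Qed.

Lemma c3bar00 : c3bar 0 0 = -4 :> R.
Proof. by rewrite /c3bar addr0 sqrtr1; field. Qed.

(** Sturm comparison with the explicit solution [-4 y] at [c_3 = -4]: for
    [c_3 < -4] the function [E] would be strictly decreasing on [[-1, 1]]
    while vanishing at both ends. *)
Lemma c3_lower_bound c3 U : Utheta_ode 0 0 c3 U -> c3bar 0 0 <= c3.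
Proof.
move=> HU; rewrite c3bar00 leNgt; apply/negP => c34.
have [_ Uc _] := HU.
pose E y := (1 - y ^+ 2) * (U y + 4 * y).
have dE y : -1 < y < 1 -> is_derive y (1 : R) E
    ((c3 + 4) * (1 - y ^+ 2) - 2^-1 * (U y + 4 * y) ^+ 2).
  move=> y1; have dU := Utheta_derive HU y1; have y0 := sqr_lt1 y1.
  have yn0 : 1 - y ^+ 2 != 0 by rewrite gt_eqF.
  rewrite /E; isd_by; rewrite (Utheta_derive1E HU y1) /=; field.
  exact: yn0.
have Ec : {within `[-1, 1], continuous E}.
  apply/continuous_within_itvP; first exact: gtrN ltr01.
  split.
  - by move=> y; rewrite in_itv /= => /dE /isd_continuous.
  - apply: cvgM.
      apply: cvgB; first exact: cvg_cst.
      exact: (cvg_comp _ _ cvg_rightN1 (@exprn_continuous R 2 (-1))).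
    apply: cvgD; first exact: within_cvgN1.
    by apply: cvgM; [exact: cvg_cst | exact: cvg_rightN1].
  - apply: cvgM.
      apply: cvgB; first exact: cvg_cst.
      exact: (cvg_comp _ _ cvg_left1 (@exprn_continuous R 2 1)).
    apply: cvgD; first exact: within_cvg1.
    by apply: cvgM; [exact: cvg_cst | exact: cvg_left1].
have Ed y : y \in `]-1, 1[ -> derivable E y 1 by rewrite in_itv /= => /dE[].
have E1 : E (-1) = E 1 by rewrite /E sqrrN expr1n subrr !mul0r.
have [c + dEc] := Rolle (gtrN ltr01) Ed Ec E1.
rewrite in_itv /= => c1; have := isd_unique (dE c c1) dEc.
have := sqr_lt1 c1; have := sqr_ge0 (U c + 4 * c).
by move=> ? ?; nra.
Qed.

Lemma reflect_derive U y : derivable U (- y) 1 ->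
  is_derive y (1 : R) (fun y => - U (- y)) (derive1 U (- y)).
Proof.
move=> /isdP dU; apply: isd_eq (isdN (isd_comp (isdN (isd_id y)) dU)) _.
by rewrite mulrN1 opprK.
Qed.

Lemma Utheta_ode_reflect c3 U : Utheta_ode 0 0 c3 U -> Utheta_ode 0 0 c3 (fun y => - U (- y)).
Proof.
move=> HU; have [_ Uc UE] := HU.
have N1 y : -1 < y < 1 -> -1 < - y < 1 by lra.
have dV y : -1 < y < 1 -> is_derive y (1 : R) (fun y => - U (- y)) (derive1 U (- y)).
  by move=> y1; apply: reflect_derive; case: (Utheta_derive HU (N1 y y1)).
have VE y : -1 < y < 1 ->
    (1 - y ^+ 2) * derive1 (fun y => - U (- y)) y + 2 * y * (- U (- y))
    + 2^-1 * (- U (- y)) ^+ 2 = 0 * (1 - y) + 0 * (1 + y) + c3 * (1 - y ^+ 2).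
  move=> y1; rewrite (isd_val (dV y y1)).
  have := UE _ (N1 y y1); rewrite !sqrrN => H.
  have -> : c3 * (1 - y ^+ 2) = 0 * (1 - - y) + 0 * (1 + - y) + c3 * (1 - y ^+ 2).
    by ring.
  by rewrite -H; ring.
split=> //.
- move=> n y y1; apply: smooth_derive1n y1 _; apply: riccati_smooth VE.
  by move=> z /dV[].
- apply/continuous_within_itvP; first exact: gtrN ltr01.
  split.
  + by move=> y; rewrite in_itv /= => /dV /isd_continuous.
  + apply: cvgN; rewrite opprK; apply/cvg_at_rightNP; rewrite opprK.
    under eq_cvg do rewrite /= opprK.
    exact: within_cvg1.
  + apply: cvgN; apply/cvg_at_leftNP.
    under eq_cvg do rewrite /= opprK.
    exact: within_cvgN1.
Qed.

(** With [V = U / (1 - y ^ 2)] and [phi = 1 + y], the Riccati equation gives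
    [(phi ^ 2 V)' <= 2 + |c_3|] on [[-1, 0]], and [phi ^ 2 V] vanishes at
    [-1]. *)
Lemma initial_value_le c3 U : Utheta_ode 0 0 c3 U -> U 0 <= 2 + `|c3|.
Proof.
move=> HU; have [_ Uc _] := HU.
pose E y := (1 + y) * U y / (1 - y).
pose dE y := (2 - 2^-1 * (2 - U y / (1 - y)) ^+ 2 + c3 * (1 + y) / (1 - y)).
have Ed y : -1 < y < 1 -> is_derive y (1 : R) E (dE y).
  move=> y1; have dU := Utheta_derive HU y1; have y0 := sqr_lt1 y1.
  have yn0 : 1 - y ^+ 2 != 0 by rewrite gt_eqF.
  have yn1 : 1 - y != 0 by rewrite gt_eqF //; lra.
  rewrite /E; isd_by; rewrite (Utheta_derive1E HU y1) /dE /=; field.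
  by rewrite yn1 yn0.
have Ec : {within `[-1, 0], continuous E}.
  apply/continuous_within_itvP; first by rewrite oppr_lt0.
  split.
  - by move=> y; rewrite in_itv /= => y1; apply: (@isd_continuous _ _ _ (dE y));
    apply: Ed; lra.
  - apply: cvgM.
      apply: cvgM; last exact: within_cvgN1.
      by apply: cvgD; [exact: cvg_cst | exact: cvg_rightN1].
    apply: cvgV; first by rewrite opprK.
    by apply: cvgB; [exact: cvg_cst | exact: cvg_rightN1].
  - apply: cvg_at_left_filter.
    by apply: (@isd_continuous _ _ _ (dE 0)); apply: Ed; lra.
have Ed' y : y \in `]-1, 0[ -> is_derive y (1 : R) E (dE y).
  by rewrite in_itv /= => y1; apply: Ed; lra.
have [|c + Hc] := MVT _ Ed' Ec; first by rewrite oppr_lt0.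
rewrite in_itv /= => /andP[c1 c2].
have E0 : E 0 = U 0 by rewrite /E addr0 subr0 mul1r divr1.
have EN1 : E (-1) = 0 by rewrite /E subrr !mul0r.
move: Hc; rewrite E0 EN1 subr0 opprK add0r mulr1 => ->.
rewrite /dE -addrA lerD2l.
have H1 : c3 * (1 + c) / (1 - c) <= `|c3|.
  have q : 0 <= (1 + c) / (1 - c) <= 1.
    by rewrite divr_ge0 ?ler_pdivrMr /=; lra.
  rewrite -mulrA; apply: le_trans (ler_norm _) _.
  rewrite normrM ler_piMr // ger0_norm //; by case/andP: q.
by have := sqr_ge0 (2 - U c / (1 - c)); lra.
Qed.

Lemma initial_value_bound c3 U : Utheta_ode 0 0 c3 U -> `|U 0| <= 2 + `|c3|.
Proof.
move=> HU; rewrite ler_norml (initial_value_le HU) andbT lerNl.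
by have := initial_value_le (Utheta_ode_reflect HU); rewrite oppr0.
Qed.

(** The difference of two solutions satisfies a homogeneous linear equation in
    [(-1, 1)]; continuity takes care of the end points. *)
Lemma Utheta_unique c1 c2 c3 U V : Utheta_ode c1 c2 c3 U -> Utheta_ode c1 c2 c3 V ->
  V 0 = U 0 -> forall y, -1 <= y <= 1 -> V y = U y.
Proof.
move=> HU HV UV0.
have [_ Uc _] := HU; have [_ Vc _] := HV.
pose G y := - (2 * y + 2^-1 * (V y + U y)) / (1 - y ^+ 2).
have dD y : -1 < y < 1 -> is_derive y (1 : R) (fun y => V y - U y) (G y * (V y - U y)).
  move=> y1; have dU := Utheta_derive HU y1; have dV := Utheta_derive HV y1.
  have yn0 : 1 - y ^+ 2 != 0 by rewrite gt_eqF // sqr_lt1.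
  isd_by; rewrite (Utheta_derive1E HU y1) (Utheta_derive1E HV y1) /G; field.
  exact: yn0.
have Gc y : -1 < y < 1 -> {for y, continuous G}.
  move=> y1; have dU := Utheta_derive HU y1; have dV := Utheta_derive HV y1.
  have yn0 : 1 - y ^+ 2 != 0 by rewrite gt_eqF // sqr_lt1.
  suff [X] : exists X, is_derive y (1 : R) G X by exact: isd_continuous.
  by rewrite /G; eexists; isd.
have int y : -1 < y < 1 -> V y = U y.
  move=> y1; apply/eqP; rewrite -subr_eq0; apply/eqP.
  have z1 : -1 < (0 : R) < 1 by rewrite oppr_lt0 ltr01.
  apply: (linear_ode_zero z1 y1 Gc dD).
  by rewrite UV0 subrr.
move=> y /andP[yN1 y1].
have [y1E|] := eqVneq y 1.
  have VU1 : V y @[y --> (1:R)^'-] --> U 1.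
    apply: cvg_trans (within_cvg1 Uc); apply: near_eq_cvg; near=> z.
    apply/esym/int/andP; split; near: z; last exact: nbhs_left_lt.
    exact/nbhs_left_gt/gtrN.
  by rewrite y1E; exact: (norm_cvg_unique (within_cvg1 Vc) VU1).
have [yN1E|] := eqVneq y (-1).
  have VUN1 : V y @[y --> (-1:R)^'+] --> U (-1).
    apply: cvg_trans (within_cvgN1 Uc); apply: near_eq_cvg; near=> z.
    apply/esym/int/andP; split; near: z; first exact: nbhs_right_gt.
    exact/nbhs_right_lt/gtrN.
  by move=> _; rewrite yN1E; exact: (norm_cvg_unique (within_cvgN1 Vc) VUN1).
by move=> yn yn'; apply: int; rewrite !lt_neqAle yN1 y1 yn' eq_sym yn.
Unshelve. all: by end_near. Qed.

End Riccati.

(** * Logarithmic asymptotics at a pole *)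

Section Asymptotics.
Variable R : realType.
Implicit Types (U q l : R -> R) (y : R).

(** L'Hopital's rule at an infinite limit, for a ratio of derivatives tending to
    [0]: near [b] the functions [q + (e / 2) l] and [- q + (e / 2) l] are
    nonincreasing. *)
Lemma little_o_primitive q l (dq dl : R -> R) (a b : R) : a < b ->
  (forall y, a < y < b -> is_derive y (1 : R) q (dq y)) ->
  (forall y, a < y < b -> is_derive y (1 : R) l (dl y)) ->
  (forall e : R, 0 < e -> \forall y \near b^'-, `|dq y| <= e * - dl y) ->
  l y @[y --> b^'-] --> -oo ->
  q y / l y @[y --> b^'-] --> (0 : R).
Proof.
move=> ab dqE dlE dql lNoo; apply/cvgr0Pnorm_le => e e0.
have e20 : 0 < e / 2 by rewrite divr_gt0.
have lneg : \forall y \near b^'-, l y < 0.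
  by move/cvgrNy_lt : lNoo; apply.
have [r /= r0 Hr] : \forall y \near b^'-,
    [/\ `|dq y| <= e / 2 * - dl y, l y < 0 & a < y].
  near=> y; split.
  - by near: y; exact: dql.
  - by near: y; exact: lneg.
  - by near: y; exact: nbhs_left_gt.
pose y0 := b - r / 2.
have y0b : y0 < b by rewrite /y0 ltrBlDr ltrDl divr_gt0.
have H y : y0 <= y < b -> [/\ `|dq y| <= e / 2 * - dl y, l y < 0 & a < y].
  move=> /andP[y1 y2]; apply: Hr => //=.
  rewrite ger0_norm ?subr_ge0 ?ltW //; move: y1; rewrite /y0; lra.
have est y : y0 < y < b -> `|q y| <= `|q y0| + e / 2 * `|l y|.
  move=> /andP[y1 y2].
  have inab z : y0 <= z <= y -> a < z < b.
    move=> /andP[z1 z2]; have zb := le_lt_trans z2 y2.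
    by have [|_ _ ->] := H z; rewrite ?z1 ?zb.
  have d1 z (Hz : y0 <= z <= y) :=
     isdD (dqE z (inab z Hz)) (isdM (isd_cst (e / 2) z) (dlE z (inab z Hz))).
  have d2 z (Hz : y0 <= z <= y) :=
     isdD (isdN (dqE z (inab z Hz))) (isdM (isd_cst (e / 2) z) (dlE z (inab z Hz))).
  have [c1 /andP[c11 c12] E1] := mvt_closed y1 d1.
  have [c2 /andP[c21 c22] E2] := mvt_closed y1 d2.
  have [|+ _ _] := H c1; first by rewrite (ltW c11) (lt_trans c12).
  rewrite ler_norml => /andP[B11 B12].
  have [|+ _ _] := H c2; first by rewrite (ltW c21) (lt_trans c22).
  rewrite ler_norml => /andP[B21 B22].
  have yy0 : 0 < y - y0 by rewrite subr_gt0.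
  have {}E1 : q y + e / 2 * l y - (q y0 + e / 2 * l y0) <= 0.
    rewrite E1 /=; apply: mulr_le0_ge0; last exact: ltW.
    by move: B12; lra.
  have {}E2 : - q y + e / 2 * l y - (- q y0 + e / 2 * l y0) <= 0.
    rewrite E2 /=; apply: mulr_le0_ge0; last exact: ltW.
    by move: B21; lra.
  have [|_ ly0 _] := H y0; first by rewrite lexx.
  have [|_ ly _] := H y; first by rewrite ltW.
  have el0 : e / 2 * l y0 < 0 by rewrite pmulr_rlt0.
  rewrite (ltr0_norm ly) ler_norml mulrN.
  have := ler_norm (q y0); have := ler_norm (- q y0); rewrite normrN.
  by move: E1 E2 el0; lra.
near=> y.
have ly : l y < - (2 * `|q y0| / e + 1).
  by near: y; move/cvgrNy_lt : lNoo; apply.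
have q0 : 0 <= 2 * `|q y0| / e by rewrite divr_ge0 ?mulr_ge0 // ltW.
have ly0 : l y < 0 by lra.
rewrite normrM normfV ler_pdivrMr ?normr_gt0 ?lt_eqF //.
have /est : y0 < y < b.
  by apply/andP; split; near: y; [exact: nbhs_left_gt | exact: nbhs_left_lt].
have : `|q y0| <= e / 2 * `|l y|.
  rewrite (ltr0_norm ly0).
  have : 2 * `|q y0| / e <= - l y by lra.
  by rewrite ler_pdivrMr //; lra.
by lra.
Unshelve. all: by end_near. Qed.

Lemma axis_dist_cvg0 : axis_dist y @[y --> (1 : R)^'-] --> (0 : R).
Proof.
have H : (1 - y ^+ 2) @[y --> (1 : R)^'-] --> (0 : R).
  rewrite (_ : 0 = 1 - 1 ^+ 2 :> R); last by rewrite expr1n subrr.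
  apply: cvgB; first exact: cvg_cst.
  exact: (cvg_comp _ _ (@cvg_left1 R) (@exprn_continuous R 2 1)).
rewrite -[X in _ --> X](@sqrtr0 R).
by apply: cvg_comp H _; exact: sqrt_continuous.
Qed.

Lemma near_left1 : \forall y \near (1 : R)^'-, 2^-1 < y < 1.
Proof.
near=> y; apply/andP; split; near: y; last exact: nbhs_left_lt.
by apply: nbhs_left_gt; rewrite invf_lt1 // ltr1n.
Unshelve. all: by end_near. Qed.

Lemma axis_dist_sqr y : -1 < y < 1 -> axis_dist y ^+ 2 = 1 - y ^+ 2.
Proof. by move=> /sqr_lt1 y1; rewrite sqr_sqrtr // ltW. Qed.

Lemma axis_dist_gt0 y : -1 < y < 1 -> 0 < axis_dist y.
Proof. by move=> /sqr_lt1 y1; rewrite sqrtr_gt0. Qed.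

Lemma axis_dist_le1 y : axis_dist y <= 1.
Proof. by rewrite -[leRHS]sqrtr1 ler_wsqrtr // gerBl sqr_ge0. Qed.

Lemma ln_axis_dist_cvg : ln (axis_dist y) @[y --> (1 : R)^'-] --> -oo.
Proof.
apply/cvgrNyPle => A.
have /cvgrNyPle/(_ A) [e /= e0 He] := @lnNy R.
near=> y; apply: He => /=.
- rewrite sub0r normrN; near: y; apply: cvgr0_norm_lt e0; exact: axis_dist_cvg0.
- have y1 : 2^-1 < y < 1 by near: y; exact: near_left1.
  by apply: axis_dist_gt0; lra.
Unshelve. all: by end_near. Qed.

Lemma ln_axis_dist_derive y : -1 < y < 1 ->
  is_derive y (1 : R) (fun y => ln (axis_dist y)) (- y / (1 - y ^+ 2)).
Proof.
move=> y1; have y0 := sqr_lt1 y1; have Sy := axis_dist_gt0 y1.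
have dl : is_derive (1 - y ^+ 2) (1 : R) (@ln R) (1 - y ^+ 2)^-1.
  exact: is_derive1_ln.
have dp : is_derive y (1 : R) (fun y => 1 - y ^+ 2) (- (2 * y)).
  by isd_by; rewrite /=; ring.
have H : is_derive y (1 : R) (fun y => 2^-1 * ln (1 - y ^+ 2)) (- y / (1 - y ^+ 2)).
  apply: isd_eq (isdM (isd_cst 2^-1 y) (isd_comp dp dl)) _.
  by field; rewrite gt_eqF.
apply: (isd_ext y1 _ H) => z z1.
by rewrite -axis_dist_sqr // lnXn ?axis_dist_gt0 // mulr2n; field.
Qed.

Lemma axis_dist_ln_cvg0 : axis_dist y * ln (axis_dist y) @[y --> (1 : R)^'-] --> (0 : R).
Proof.
apply: (cvg0_le_sqrt (C := 2) axis_dist_cvg0); near=> y.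
have y1 : 2^-1 < y < 1 by near: y; exact: near_left1.
have y1' : -1 < y < 1 by lra.
rewrite normrM (gtr0_norm (axis_dist_gt0 y1')); apply: mul_ln_bound.
by rewrite axis_dist_gt0 // axis_dist_le1.
Unshelve. all: by end_near. Qed.

(** The Euclidean norm of the field [u^{c,gamma}] at height [y]. *)
Definition planar_speed U y : R :=
  Num.sqrt (derive1 U y ^+ 2 + (U y / axis_dist y) ^+ 2).

(** With [V = U / (1 - y ^ 2)] the equation reads
    [V' = c_3 / (1 - y ^ 2) - V ^ 2 / 2]. The logarithmic bound on [U'] passes
    to [V], so the quadratic term is negligible and [V] is asymptotic
    to [- c_3 ln (axis_dist y)]. *)
Lemma speed_asymptotics c3 U (M : R) : Utheta_ode 0 0 c3 U -> U 1 = 0 ->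
  (\forall y \near (1 : R)^'-, `|derive1 U y| <= M * `|ln (axis_dist y)|) ->
  planar_speed U y / ln (axis_dist y) @[y --> (1 : R)^'-] --> - 2 * `|c3|.
Proof.
move=> HU U1 UM; have [_ Uc UE] := HU.
have U0 : U y @[y --> (1:R)^'-] --> (0 : R) by rewrite -U1; exact: within_cvg1.
pose V y := U y / (1 - y ^+ 2).
pose l y : R := ln (axis_dist y).
have dV y : -1 < y < 1 -> is_derive y (1 : R) V
    ((c3 - 2^-1 * V y ^+ 2 * (1 - y ^+ 2)) / (1 - y ^+ 2)).
  move=> y1; have dU := Utheta_derive HU y1.
  have yn0 : 1 - y ^+ 2 != 0 by rewrite gt_eqF // sqr_lt1.
  rewrite /V; isd_by; rewrite (Utheta_derive1E HU y1) /=; field.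
  exact: yn0.
have dUE y : -1 < y < 1 -> derive1 U y = c3 - V y * (2 * y + 2^-1 * U y).
  move=> y1; have yn0 : 1 - y ^+ 2 != 0 by rewrite gt_eqF // sqr_lt1.
  by rewrite (Utheta_derive1E HU y1) /V; field.
have Vb : \forall y \near (1:R)^'-, `|V y| <= M * `|l y| + `|c3|.
  near=> y.
  have y1 : 3 / 4 < y < 1.
    apply/andP; split; near: y; last exact: nbhs_left_lt.
    by apply: nbhs_left_gt; lra.
  have Uy : `|U y| <= 1 by near: y; apply: cvgr0_norm_le ltr01.
  (* For [y > 3 / 4] and [|U| <= 1] the coefficient of [V] in the equation is
     at least [1], so [V] is bounded by [U'] and [c_3]. *)
  have D : 1 <= 2 * y + 2^-1 * U y.
    by move: Uy; rewrite ler_norml; lra.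
  have y1' : -1 < y < 1 by lra.
  have VE : V y * (2 * y + 2^-1 * U y) = c3 - derive1 U y.
    by rewrite (dUE y y1'); ring.
  apply: (@le_trans _ _ (`|V y * (2 * y + 2^-1 * U y)|)).
    by rewrite [leRHS]normrM ler_peMr // (le_trans D) // ler_norm.
  rewrite VE; apply: le_trans (ler_normB _ _) _.
  rewrite addrC lerD2r; near: y; exact: UM.
have VS : V y * axis_dist y @[y --> (1:R)^'-] --> (0 : R).
  apply: norm_cvg0.
  apply: (@squeeze_cvgr _ _ _ _ (fun=> 0)
    (fun y => M * `|axis_dist y * l y| + `|c3| * axis_dist y)).
  - near=> y; rewrite normr_ge0 /=.
    have y1 : 2^-1 < y < 1 by near: y; exact: near_left1.
    have y1' : -1 < y < 1 by lra.
    have Sy := axis_dist_gt0 y1'.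
    have Vy : `|V y| <= M * `|l y| + `|c3| by near: y.
    rewrite [X in X <= _]normrM [`|axis_dist y * l y|]normrM (gtr0_norm Sy).
    by have := ler_wpM2l (ltW Sy) Vy; lra.
  - exact: cvg_cst.
  - have H1 : M * `|axis_dist y * l y| @[y --> (1:R)^'-] --> (M * `|(0 : R)| : R).
      by apply: cvgM; [exact: cvg_cst | apply: cvg_norm; exact: axis_dist_ln_cvg0].
    have H2 : `|c3| * axis_dist y @[y --> (1:R)^'-] --> `|c3| * 0.
      by apply: cvgM; [exact: cvg_cst | exact: axis_dist_cvg0].
    have := cvgD H1 H2; rewrite normr0 !mulr0 addr0 => H; exact: H.
pose q y := V y + c3 * l y.
pose dq y := (c3 * (1 - y) - 2^-1 * (V y * axis_dist y) ^+ 2) / (1 - y ^+ 2).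
have dqE y : -1 < y < 1 -> is_derive y (1 : R) q (dq y).
  move=> y1; have yn0 : 1 - y ^+ 2 != 0 by rewrite gt_eqF // sqr_lt1.
  apply: isd_eq (isdD (dV y y1) (isdM (isd_cst c3 y) (ln_axis_dist_derive y1))) _.
  rewrite /dq [(V y * axis_dist y) ^+ 2]exprMn axis_dist_sqr //; field.
  exact: yn0.
have numc : (c3 * (1 - y) - 2^-1 * (V y * axis_dist y) ^+ 2) @[y --> (1:R)^'-] --> (0 : R).
  rewrite (_ : 0 = c3 * (1 - 1) - 2^-1 * 0 ^+ 2 :> R); last first.
    by rewrite subrr expr0n /= !mulr0 subrr.
  apply: cvgB; apply: cvgM; try exact: cvg_cst.
    by apply: cvgB; [exact: cvg_cst | exact: cvg_left1].
  exact: (cvg_comp _ _ VS (@exprn_continuous R 2 0)).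
have dql (e : R) : 0 < e ->
    \forall y \near (1:R)^'-, `|dq y| <= e * - (- y / (1 - y ^+ 2)).
  move=> e0; near=> y.
  have y1 : 2^-1 < y < 1 by near: y; exact: near_left1.
  have y1' : -1 < y < 1 by lra.
  have y0 := sqr_lt1 y1'.
  rewrite /dq mulNr opprK [leLHS]normrM normfV (gtr0_norm y0) [leRHS]mulrA.
  rewrite ler_pM2r ?invr_gt0 //.
  apply: (@le_trans _ _ (e / 2)).
    by near: y; apply: cvgr0_norm_le numc _ _; rewrite divr_gt0.
  by rewrite ler_pM2l //; lra.
have ql : q y / l y @[y --> (1:R)^'-] --> (0 : R).
  exact: (little_o_primitive (gtrN ltr01) dqE ln_axis_dist_derive dql ln_axis_dist_cvg).
have lneg : \forall y \near (1:R)^'-, l y < 0.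
  by move/cvgrNy_lt : ln_axis_dist_cvg; apply.
have Vl : V y / l y @[y --> (1:R)^'-] --> - c3.
  have : q y / l y - c3 @[y --> (1:R)^'-] --> 0 - c3.
    by apply: cvgB => //; exact: cvg_cst.
  rewrite sub0r; apply: cvg_trans; apply: near_eq_cvg.
  near=> y; have ly : l y < 0 by near: y.
  by rewrite /q; field; rewrite lt_eqF.
have lV : (l y)^-1 @[y --> (1:R)^'-] --> (0:R).
  by apply/(ltr0_cvgV0 lneg).2; exact: ln_axis_dist_cvg.
have dUl : derive1 U y / l y @[y --> (1:R)^'-] --> 2 * c3.
  have : c3 * (l y)^-1 - V y / l y * (2 * y + 2^-1 * U y) @[y --> (1:R)^'-]
       --> c3 * 0 - - c3 * (2 * 1 + 2^-1 * 0).
    apply: cvgB; apply: cvgM => //; first exact: cvg_cst.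
    apply: cvgD; apply: cvgM => //; try exact: cvg_cst.
    exact: cvg_left1.
  rewrite (_ : _ - _ = 2 * c3); last by ring.
  apply: cvg_trans; apply: near_eq_cvg; near=> y.
  have y1 : 2^-1 < y < 1 by near: y; exact: near_left1.
  by rewrite dUE; [ring | lra].
have USl : U y / axis_dist y / l y @[y --> (1:R)^'-] --> (0 : R).
  have : axis_dist y * (V y / l y) @[y --> (1:R)^'-] --> 0 * - c3.
    by apply: cvgM => //; exact: axis_dist_cvg0.
  rewrite mul0r; apply: cvg_trans; apply: near_eq_cvg; near=> y.
  have y1 : 2^-1 < y < 1 by near: y; exact: near_left1.
  have y1' : -1 < y < 1 by lra.
  have ly : l y < 0 by near: y.
  rewrite /V -axis_dist_sqr //; field.
  by rewrite lt_eqF //= gt_eqF // axis_dist_gt0.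
have E : - Num.sqrt ((derive1 U y / l y) ^+ 2 + (U y / axis_dist y / l y) ^+ 2)
    @[y --> (1:R)^'-] --> - 2 * `|c3|.
  rewrite (_ : - 2 * `|c3| = - Num.sqrt ((2 * c3) ^+ 2 + 0 ^+ 2)); last first.
    by rewrite expr0n addr0 sqrtr_sqr normrM ger0_norm // mulNr.
  apply: cvgN.
  have : (derive1 U y / l y) ^+ 2 + (U y / axis_dist y / l y) ^+ 2 @[y --> (1:R)^'-]
      --> (2 * c3) ^+ 2 + 0 ^+ 2.
    apply: cvgD.
      exact: (cvg_comp _ _ dUl (@exprn_continuous R 2 _)).
    exact: (cvg_comp _ _ USl (@exprn_continuous R 2 _)).
  move=> H; apply: cvg_comp H _; exact: sqrt_continuous.
apply: cvg_trans E; apply: near_eq_cvg; near=> y.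
have ly : l y < 0 by near: y.
rewrite /planar_speed.
have -> : (derive1 U y / l y) ^+ 2 + (U y / axis_dist y / l y) ^+ 2
   = (derive1 U y ^+ 2 + (U y / axis_dist y) ^+ 2) * (l y)^-1 ^+ 2 by ring.
rewrite sqrtrM; last by rewrite addr_ge0 ?sqr_ge0.
by rewrite sqrtr_sqr normfV (ltr0_norm ly) invrN mulrN opprK.
Unshelve. all: by end_near. Qed.

End Asymptotics.

(** * From polar profiles to the family, and approach to the poles *)

Section PolarProfile.
Variable R : realType.
Implicit Types (f g : R -> R) (t y : R).

Lemma axis_dist_cvg0N : axis_dist y @[y --> (-1 : R)^'+] --> (0 : R).
Proof.
apply/cvg_at_rightNP; rewrite opprK.
under eq_cvg do rewrite /= /axis_dist sqrrN.
exact: axis_dist_cvg0.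
Qed.

Lemma axis_dist_pole y : y ^+ 2 = 1 -> axis_dist y = 0.
Proof. by move=> y2; rewrite /axis_dist y2 subrr sqrtr0. Qed.

(** From the polar profile [f], [g] of a swirl-free flow to the Riccati
    equation: the logarithmic bounds force the constants [a] and [b] of the
    first integral to vanish. *)
Lemma polar_Utheta f g (a b c3 M d : R) : 0 < d <= 1 -> 0 <= M ->
  (forall t, 0 < t < pi -> is_derive t (1 : R) g (derive1 g t)) ->
  (forall t, 0 < t < pi -> f t + derive1 g t + g t * (cos t / sin t) = 0) ->
  (forall t, 0 < t < pi ->
    sin t ^+ 2 * f t + 2 * cos t * (g t * sin t) + 2^-1 * (g t * sin t) ^+ 2
    = a + b * cos t + c3 * sin t ^+ 2) ->
  (forall t, 0 < t < pi -> sin t < d -> `|f t| <= M * `|ln (sin t)|) ->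
  (forall t, 0 < t < pi -> sin t < d -> `|g t| <= M * `|ln (sin t)|) ->
  Utheta_ode 0 0 c3 (of_polar g).
Proof.
move=> d01 M0 dg dv FI fb gb.
have [d0 d1] := andP d01.
have [f0 fpi] := log_times_sin_cvg d01 M0 fb.
have [g0 gpi] := log_times_sin_cvg d01 M0 gb.
have lim_side (F : set_system R) (FF : ProperFilter F) (s : R) :
    (\forall t \near F, 0 < t < pi) ->
    f t * sin t @[t --> F] --> (0 : R) -> g t * sin t @[t --> F] --> (0 : R) ->
    sin t @[t --> F] --> (0 : R) -> cos t @[t --> F] --> s -> a + b * s = 0.
  move=> Fpi fs gs sF cF.
  have H1 : sin t * (f t * sin t) + 2 * cos t * (g t * sin t)
       + 2^-1 * (g t * sin t) ^+ 2 - c3 * sin t ^+ 2 @[t --> F]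
      --> 0 * 0 + 2 * s * 0 + 2^-1 * 0 ^+ 2 - c3 * 0 ^+ 2.
    have sq (w : R -> R) (l : R) : w t @[t --> F] --> l -> w t ^+ 2 @[t --> F] --> l ^+ 2.
      by move=> H; exact: (cvg_comp _ _ H (@exprn_continuous R 2 _)).
    apply: cvgB; last by apply: cvgM; [exact: cvg_cst | exact: sq].
    apply: cvgD; last by apply: cvgM; [exact: cvg_cst | exact: sq].
    apply: cvgD; first exact: cvgM.
    by apply: cvgM => //; apply: cvgM => //; exact: cvg_cst.
  have H2 : a + b * cos t @[t --> F] --> a + b * s.
    by apply: cvgD; [exact: cvg_cst | apply: cvgM => //; exact: cvg_cst].
  have H3 : a + b * cos t @[t --> F] --> (0 : R).
    rewrite (_ : 0 = 0 * 0 + 2 * s * 0 + 2^-1 * 0 ^+ 2 - c3 * 0 ^+ 2); last first.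
      by rewrite expr0n /=; ring.
    apply: cvg_trans H1; apply: near_eq_cvg; near=> t.
    have tpi : 0 < t < pi by near: t.
    have -> : a + b * cos t = a + b * cos t + c3 * sin t ^+ 2 - c3 * sin t ^+ 2 by ring.
    by rewrite -FI //; ring.
  exact: (norm_cvg_unique H2 H3).
have ab0 : a + b * 1 = 0.
  apply: (lim_side (0:R)^'+ _ 1) => //; last first.
  - by rewrite -(@cos0 R); apply: cvg_at_right_filter; exact: continuous_cos.
  - exact: sin_cvg0.
  - by apply: filterS (near_pole0 d0) => t [].
have abN : a + b * -1 = 0.
  apply: (lim_side (pi:R)^'- _ (-1)) => //; last first.
  - by rewrite -(@cospi R); apply: cvg_at_left_filter; exact: continuous_cos.
  - exact: sin_cvgpi.
  - by apply: filterS (near_polepi d0) => t [].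
have a0 : a = 0 by lra.
have b0 : b = 0 by lra.
have dU y (y1 : -1 < y < 1) := of_polar_derive dg dv y1.
have UE y : -1 < y < 1 ->
   (1 - y ^+ 2) * derive1 (of_polar g) y + 2 * y * of_polar g y
   + 2^-1 * of_polar g y ^+ 2 = 0 * (1 - y) + 0 * (1 + y) + c3 * (1 - y ^+ 2).
  move=> y1; rewrite (isd_val (dU y y1)) /of_polar.
  have := FI _ (acos_itv y1); rewrite a0 b0 cos_acos // sin_acos_itv // axis_dist_sqr //.
  by move=> ->; ring.
have Ub (F : set_system R) (FF : Filter F) : (\forall y \near F, -1 < y < 1) ->
   axis_dist y @[y --> F] --> (0 : R) -> of_polar g y @[y --> F] --> (0 : R).
  move=> F1 aF; apply: (cvg0_le_sqrt (C := M * 2) aF); near=> y.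
  have y1 : -1 < y < 1 by near: y.
  have yd : axis_dist y < d.
    apply: le_lt_trans (ler_norm _) _; near: y.
    exact: cvgr0_norm_lt d0.
  rewrite /of_polar -sin_acos_itv //.
  have yd' : sin (acos y) < d by rewrite sin_acos_itv.
  exact: (log_times_sin d1 M0 (acos_itv y1) yd' (gb _ (acos_itv y1) yd')).
split=> //.
- move=> n y y1; apply: smooth_derive1n y1 _; apply: riccati_smooth UE.
  by move=> z z1; case: (dU z z1).
- apply/continuous_within_itvP; first exact: gtrN ltr01.
  split.
  + by move=> y; rewrite in_itv /= => /dU /isd_continuous.
  + rewrite {2}/of_polar axis_dist_pole ?sqrrN ?expr1n // mulr0.
    apply: Ub; last exact: axis_dist_cvg0N.
    near=> y; apply/andP; split; near: y; first exact: nbhs_right_gt.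
    exact/nbhs_right_lt/gtrN.
  + rewrite {2}/of_polar axis_dist_pole ?expr1n // mulr0.
    apply: Ub; last exact: axis_dist_cvg0.
    near=> y; apply/andP; split; near: y; last exact: nbhs_left_lt.
    exact/nbhs_left_gt/gtrN.
Unshelve. all: by end_near. Qed.

(** The bound on initial values is what makes the infimum and the supremum in
    the definition of [gamma_minus] and [gamma_plus] genuine bounds. *)
Lemma Utheta_in_I c3 (U : R -> R) : Utheta_ode 0 0 c3 U -> in_I 0 0 c3 (U 0).
Proof.
move=> HU; split.
  by split; rewrite ?oppr_le0 //; exact: c3_lower_bound HU.
have B V : Utheta_ode 0 0 c3 V -> - (2 + `|c3|) <= V 0 <= 2 + `|c3|.
  by move=> /initial_value_bound; rewrite ler_norml.
apply/andP; split.
- apply: ge_inf; last by exists U.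
  by exists (- (2 + `|c3|)) => _ [V [/B/andP[+ _] <-]].
- apply: ub_le_sup; last by exists U.
  by exists (2 + `|c3|) => _ [V [/B/andP[_ +] <-]].
Qed.

End PolarProfile.

Section Poles.
Variable R : realType.
Implicit Types (x : 'rV[R]_3) (s y d : R).

Definition height x : R := x 0 2%:R.

Lemma sphereE x : sphere x <-> x 0 0 ^+ 2 + x 0 1 ^+ 2 + height x ^+ 2 = 1.
Proof.
rewrite /sphere /= /enorm /height dot_sum3 -!expr2; split=> [|->]; last exact: sqrtr1.
move=> /(congr1 (fun z => z ^+ 2)); rewrite sqr_sqrtr ?expr1n //.
by rewrite !addr_ge0 ?sqr_ge0.
Qed.

Lemma enorm'_sphere x : sphere x -> enorm' x = axis_dist (height x).
Proof. by move=> /sphereE H; rewrite /enorm' /axis_dist -H; congr Num.sqrt; ring. Qed.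

Lemma sphere_height x : sphere x -> -1 <= height x <= 1.
Proof.
move=> /sphereE H; have := sqr_ge0 (x 0 0); have := sqr_ge0 (x 0 1).
by move=> ? ?; apply/andP; split; nra.
Qed.

Lemma sphere_height_pole x s : s ^+ 2 = 1 -> sphere x -> height x = s -> x = vec3 0 0 s.
Proof.
move=> s2 /sphereE + E; rewrite E s2 => H.
have := sqr_ge0 (x 0 0); have := sqr_ge0 (x 0 1) => h1 h0.
have x0 : x 0 0 = 0 by apply/eqP; rewrite -sqrf_eq0 eq_le h0 andbT; lra.
have x1 : x 0 1 = 0 by apply/eqP; rewrite -sqrf_eq0 eq_le h1 andbT; lra.
apply/rowP => i; case: i => -[|[|[|//]]] hi; rewrite !mxE /=.
- by rewrite -x0; congr (x _ _); exact/val_inj.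
- by rewrite -x1; congr (x _ _); exact/val_inj.
- by rewrite -E; congr (x _ _); exact/val_inj.
Qed.

Lemma sphere_polar x : sphere x -> -1 < height x < 1 ->
  exists p : R, x = sph 1 (acos (height x)) p.
Proof.
move=> sx z1; have /sphereE H := sx.
set z := height x in z1 H *.
have a0 := axis_dist_gt0 z1; have a2 := axis_dist_sqr z1.
pose c := x 0 0 / axis_dist z.
have c2 : c ^+ 2 = 1 - (x 0 1 / axis_dist z) ^+ 2.
  rewrite /c !expr_div_n a2; have z0 := sqr_lt1 z1.
  have -> : x 0 0 ^+ 2 = 1 - z ^+ 2 - x 0 1 ^+ 2 by rewrite -H; ring.
  by field; rewrite gt_eqF.
have c1 : -1 <= c <= 1.
  by have := sqr_ge0 (x 0 1 / axis_dist z) => ?; apply/andP; split; nra.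
have sc : sin (acos c) = `|x 0 1| / axis_dist z.
  rewrite sin_acos // c2 opprB addrC subrK sqrtr_sqr normrM normfV.
  by rewrite (gtr0_norm a0).
have cc : cos (acos c) = c by rewrite acosK // in_itv.
have [p [cp sp]] : exists p : R, cos p = c /\ sin p = x 0 1 / axis_dist z.
  have [x1|x1] := leP 0 (x 0 1).
    by exists (acos c); rewrite sc ger0_norm.
  by exists (- acos c); rewrite cosN sinN sc ltr0_norm // mulNr opprK.
exists p; apply/rowP => i.
rewrite /sph /e_r sin_acos_itv // cos_acos // cp sp.
case: i => -[|[|[|//]]] hi; rewrite !mxE /= mul1r.
- rewrite /c mulrCA divff ?gt_eqF // mulr1; congr (x _ _); exact/val_inj.
- rewrite mulrCA divff ?gt_eqF // mulr1; congr (x _ _); exact/val_inj.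
- by congr (x _ _); exact/val_inj.
Qed.

(** Approaching the pole [(0, 0, s)] along the sphere means that the height,
    normalised by the sign [s], increases to [1]. *)
Lemma height_to_pole s : s ^+ 2 = 1 ->
  s * height x @[x --> to_pole (vec3 0 0 s)] --> (1 : R)^'-.
Proof.
move=> s2 A [e /= e0 HA].
have hz : height x @[x --> (vec3 0 0 s : 'rV[R]_3)] --> s.
  rewrite -[X in _ --> X](_ : height (vec3 0 0 s) = s); last by rewrite /height mxE.
  exact: (@coord_continuous R 1 3 0 2%:R (vec3 0 0 s)).
have cz : s * height x @[x --> (vec3 0 0 s : 'rV[R]_3)] --> (1 : R).
  by rewrite -s2 expr2; apply: cvgM hz; exact: cvg_cst.
have xe := (cvgrPdist_lt (FF := nbhs_filter _) _ _).1 cz e e0.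
change (nbhs (vec3 0 0 s : 'rV[R]_3)
  [set x | (sphere `\ vec3 0 0 s) x -> A (s * height x)]).
apply: (@filterS _ _ (nbhs_filter _) _ _ _ xe) => {xe} x xe [sx xP].
apply: HA => //=.
rewrite lt_neqAle; apply/andP; split; last by have := sphere_height sx => ?; nra.
apply/negP => /eqP E; apply: xP; apply: sphere_height_pole => //.
by rewrite -[RHS]mulr1 -E mulrA -expr2 s2 mul1r.
Qed.

(** A curve on the sphere into the pole: it makes limits along [to_pole]
    unique. *)
Lemma pole_curve s : s ^+ 2 = 1 ->
  vec3 (axis_dist y) 0 (s * y) @[y --> (1 : R)^'-] --> to_pole (vec3 0 0 s).
Proof.
move=> s2.
have cv : vec3 (axis_dist y) 0 (s * y) @[y --> (1 : R)^'-] --> vec3 0 0 s.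
  apply/cvgrPdist_lt => e e0; near=> y.
  rewrite [X in X < _]/Num.Def.normr /= mx_normrE.
  apply: bigmax_lt => // -[i j] _; rewrite !mxE /=.
  case: j => -[|[|[|//]]] hj /=.
  - rewrite sub0r normrN; near: y; apply: cvgr0_norm_lt e0; exact: axis_dist_cvg0.
  - by rewrite subrr normr0.
  - have -> : s - s * y = s * (1 - y) by ring.
    have -> : `|s * (1 - y)| = `|1 - y|.
      have : `|s| ^+ 2 = 1 by rewrite -normrX s2 normr1.
      move/eqP; rewrite sqrf_eq1 => /orP[|] /eqP sE.
        by rewrite normrM sE mul1r.
      by have := normr_ge0 s; rewrite sE; lra.
    near: y; move/cvgrPdist_lt : (@cvg_left1 R); exact.
move=> A HA; have {}HA : nbhs (vec3 0 0 s) [set x | (sphere `\ vec3 0 0 s) x -> A x] by [].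
have := cv _ HA; rewrite /nbhs /= => H.
near=> y; have y1 : 2^-1 < y < 1 by near: y; exact: near_left1.
have y1' : -1 < y < 1 by lra.
have : (sphere `\ vec3 0 0 s) (vec3 (axis_dist y) 0 (s * y)).
  split.
    apply/sphereE; rewrite /height !mxE /= axis_dist_sqr // exprMn s2; ring.
  move=> /(congr1 (fun v : 'rV[R]_3 => v 0 0)); rewrite !mxE /=.
  by apply/eqP; rewrite gt_eqF // axis_dist_gt0.
by near: y; exact: H.
Unshelve. all: by end_near. Qed.

End Poles.

(** * Solutions with a logarithmic bound *)

Section Limsup.
Variable R : realType.

Lemma limf_esup_bounded (T : choiceType) (X : filteredType T)
    (F : set_system X) (phi : X -> R) :
  (limf_esup (fun x => (phi x)%:E) F < +oo)%E ->
  exists A (M : R), [/\ F A, 0 <= M & forall x, A x -> phi x <= M].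
Proof.
rewrite /limf_esup => /ereal_inf_lt [_ [A FA <-]] H.
exists A, (Num.max 0 (fine (ereal_sup [set (phi x)%:E | x in A]))).
split => //; first by rewrite le_max lexx.
move=> x Ax.
have : ((phi x)%:E <= ereal_sup [set (phi x)%:E | x in A])%E.
  by apply: ereal_sup_ubound; exists x.
case: (ereal_sup _) H => [r _|//|]; last by rewrite leeNy_eq.
by rewrite lee_fin /= le_max => ->; rewrite orbT.
Qed.

Lemma limf_esup_le (T : choiceType) (X : filteredType T)
    (F : set_system X) (phi : X -> R) A (M : R) :
  F A -> (forall x, A x -> phi x <= M) ->
  (limf_esup (fun x => (phi x)%:E) F <= M%:E)%E.
Proof.
move=> FA AM; apply: (@le_trans _ _ (ereal_sup [set (phi x)%:E | x in A])).
  by apply: ereal_inf_lbound; exists A.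
by apply: ge_ereal_sup => _ [x Ax <-]; rewrite lee_fin AM.
Qed.

End Limsup.

Section Structure.
Variable R : realType.
Implicit Types (u : 'rV[R]_3 -> 'rV[R]_3).
Local Notation Omega := (@sphere R `\` [set south; north]).

Lemma sphere_sph1 t p : @sphere R (sph 1 t p).
Proof. exact: enorm_sph. Qed.

Lemma height_sph1 t p : height (sph 1 t p) = cos t :> R.
Proof. by rewrite /height !mxE /= mul1r. Qed.

Lemma axis_dist_cos (t : R) : 0 < t < pi -> axis_dist (cos t) = sin t.
Proof.
move=> /sin_gt0_pi st; rewrite /axis_dist -sin2cos2 sqrtr_sqr gtr0_norm //.
Qed.

Lemma enorm'_sph1 t p : 0 < t < pi -> enorm' (sph 1 t p) = sin t :> R.
Proof.
by move=> tpi; rewrite (enorm'_sphere (sphere_sph1 t p)) height_sph1 axis_dist_cos.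
Qed.

Lemma log_bound_polar u :
  (limf_esup (fun x => (enorm (u x) / `|ln (enorm' x)|)%:E) to_axis < +oo)%E ->
  exists M d : R, [/\ 0 < d <= 1, 0 <= M & forall t p, 0 < t < pi -> sin t < d ->
    enorm (u (sph 1 t p)) <= M * `|ln (sin t)|].
Proof.
move=> /limf_esup_bounded [A [M [[d /= d0 dA] M0 AM]]].
(* Below [1 / 2] the logarithm is nonzero, so that the bound on the quotient
   can be multiplied out. *)
exists M, (Num.min d 2^-1); split=> //.
  rewrite lt_min d0 ge_min /=; apply/andP; split; first by lra.
  by apply/orP; right; lra.
move=> t p tpi; rewrite lt_min => /andP[td t2].
have st := sin_gt0_pi tpi.
have := AM (sph 1 t p); rewrite enorm'_sph1 // ler_pdivrMr; last first.
  by rewrite normr_gt0 lt_eqF // ln_lt0 // st /=; lra.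
apply; apply: dA; split; first exact: sphere_sph1.
by rewrite enorm'_sph1 // st.
Qed.

Lemma enorm_polar u (f g h : R) t p :
  (forall j, u (sph 1 t p) 0 j = f * er t p j + g * et t p j + h * ep p j) ->
  enorm (u (sph 1 t p)) = Num.sqrt (f ^+ 2 + g ^+ 2 + h ^+ 2).
Proof.
move=> H; rewrite /enorm /dot; under eq_bigr => i _ do rewrite H.
by rewrite frame_dot -!expr2.
Qed.

Lemma norm_le_sqrt3 (a b c : R) :
  [/\ `|a| <= Num.sqrt (a ^+ 2 + b ^+ 2 + c ^+ 2),
      `|b| <= Num.sqrt (a ^+ 2 + b ^+ 2 + c ^+ 2) &
      `|c| <= Num.sqrt (a ^+ 2 + b ^+ 2 + c ^+ 2)].
Proof.
have := sqr_ge0 a; have := sqr_ge0 b; have := sqr_ge0 c => hc hb ha.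
by split; rewrite -sqrtr_sqr ler_wsqrtr //; lra.
Qed.

Global Instance to_pole_filter (P : 'rV[R]_3) : Filter (to_pole P).
Proof. exact: within_filter. Qed.

Lemma near_to_pole_sphere (s : R) : \forall x \near to_pole (vec3 0 0 s), sphere x.
Proof.
rewrite near_withinE; apply: (@filterS _ _ (nbhs_filter _) setT); last exact: filterT.
by move=> x _ [].
Qed.

(** The limit at the pole of height [s] is the limit of a function of the
    normalised height, because the flow is axisymmetric. *)
Lemma pole_limit u (U : R -> R) c3 (M d s : R) : s ^+ 2 = 1 ->
  Utheta_ode 0 0 c3 U -> U 1 = 0 -> 0 < d <= 1 ->
  (forall y p, -1 < y < 1 ->
     enorm (u (sph 1 (acos (s * y)) p)) = planar_speed U y) ->
  (forall y, -1 < y < 1 -> axis_dist y < d ->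
     `|derive1 U y| <= M * `|ln (axis_dist y)|) ->
  enorm (u x) / ln (enorm' x) @[x --> to_pole (vec3 0 0 s)] --> - 2 * `|c3|.
Proof.
move=> s2 HU U1 /andP[d0 d1] uU Ub.
have Ub' : \forall y \near (1 : R)^'-, `|derive1 U y| <= M * `|ln (axis_dist y)|.
  near=> y.
  have y1 : 2^-1 < y < 1 by near: y; exact: near_left1.
  apply: Ub; first by lra.
  apply: le_lt_trans (ler_norm _) _; near: y.
  by apply: cvgr0_norm_lt d0; exact: axis_dist_cvg0.
have := speed_asymptotics HU U1 Ub'.
move=> H; have {}H := cvg_comp _ _ (height_to_pole s2) H.
apply: cvg_trans H; apply: near_eq_cvg.
have HN : \forall x \near to_pole (vec3 0 0 s), 2^-1 < s * height x < 1.
  exact: (height_to_pole s2 (near_left1 R)).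
have HS : \forall x \near to_pole (vec3 0 0 s), sphere x := near_to_pole_sphere s.
near=> x; have sx : sphere x by near: x.
have y1 : 2^-1 < s * height x < 1 by near: x.
have y1' : -1 < s * height x < 1 by lra.
have hE : height x = s * (s * height x) by rewrite mulrA -expr2 s2 mul1r.
have hx1 : -1 < height x < 1.
  have : (s - 1) * (s + 1) = 0 by rewrite -subr_sqr_1 s2 subrr.
  move/eqP; rewrite mulf_eq0 subr_eq0 addr_eq0 => /orP[|] /eqP sE.
    by move: y1'; rewrite sE mul1r.
  by move: y1'; rewrite sE mulN1r; lra.
have [p xE] := sphere_polar sx hx1.
rewrite /= enorm'_sphere // -[in LHS](uU _ p) // -hE -xE.
by rewrite /axis_dist exprMn s2 mul1r.
Unshelve. all: by end_near. Qed.

(** Both poles are treated at once through the sign [s] of their height: at the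
    pole of height [-1] the profile [U] is replaced by its reflection
    [- U (- y)], which solves the same equation. *)
Lemma solution_description u :
  homogeneous_axisym_solution Omega u ->
  (limf_esup (fun x => (enorm (u x) / `|ln (enorm' x)|)%:E) to_axis < +oo)%E ->
  no_swirl u /\
  exists (c3 : R) (U : R -> R),
    [/\ Utheta_ode 0 0 c3 U,
        forall t p, 0 < t < pi -> u (sph 1 t p)
          = derive1 U (cos t) *: e_r t p + (U (cos t) / sin t) *: e_theta t p &
        forall s, s ^+ 2 = 1 ->
          enorm (u x) / ln (enorm' x) @[x --> to_pole (vec3 0 0 s)] --> - 2 * `|c3|].
Proof.
move=> [uC2 uhom uaxi [p [pC1 phom uNS]]] /log_bound_polar [M [d [d01 M0 ub]]].
have [f [g [h [P [[hf hg hh] uE dv mom]]]]] :=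
  reduced_system uC2 uhom uaxi pC1 phom uNS.
have fgh_bound t : 0 < t < pi -> sin t < d ->
    [/\ `|f t| <= M * `|ln (sin t)|, `|g t| <= M * `|ln (sin t)| &
        `|h t| <= M * `|ln (sin t)|].
  move=> tpi td; have := ub t 0 tpi td.
  rewrite (enorm_polar (fun j => uE t 0 j tpi)) => H.
  by have [H1 H2 H3] := norm_le_sqrt3 (f t) (g t) (h t); split; apply: le_trans H.
have df t : 0 < t < pi -> is_derive t (1 : R) f (derive1 f t).
  by move=> /hf[/isdP].
have dg t : 0 < t < pi -> is_derive t (1 : R) g (derive1 g t).
  by move=> /hg[/isdP].
have gc t : 0 < t < pi -> {for t, continuous g}.
  by move=> /dg /isd_continuous.
have h0 t : 0 < t < pi -> h t = 0.
  apply: (swirl_vanishes d01 M0 gc hh) => s spi; first by have [] := mom s spi.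
  by move=> sd; have [] := fgh_bound s spi sd.
have [a [b [c3 FI]]] : exists a b c3 : R, forall t, 0 < t < pi ->
    sin t ^+ 2 * f t + 2 * cos t * (g t * sin t) + 2^-1 * (g t * sin t) ^+ 2
    = a + b * cos t + c3 * sin t ^+ 2.
  apply: (@first_integral _ f g P hf hg dv).
  - by move=> t tpi; have [E _ _] := mom t tpi; rewrite E (h0 t tpi); ring.
  - move=> t tpi; have [_ dP _] := mom t tpi.
    by apply: isd_eq dP _; rewrite h0 // expr0n /= mul0r addr0.
have fb t (tpi : 0 < t < pi) (sd : sin t < d) :=
  let: And3 H _ _ := fgh_bound t tpi sd in H.
have gb t (tpi : 0 < t < pi) (sd : sin t < d) :=
  let: And3 _ H _ := fgh_bound t tpi sd in H.
have HU := polar_Utheta d01 M0 dg dv FI fb gb.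
set U := of_polar g in HU.
have dU y : -1 < y < 1 -> derive1 U y = f (acos y).
  by move=> y1; exact: isd_val (of_polar_derive dg dv y1).
have US y : -1 < y < 1 -> U y / axis_dist y = g (acos y).
  by move=> y1; rewrite /U /of_polar mulfK // gt_eqF // axis_dist_gt0.
have cos_itv (t : R) : 0 < t < pi -> -1 < cos t < 1.
  move=> tpi; have := sin_gt0_pi tpi; have := cos2Dsin2 t => E st.
  by apply/andP; split; nra.
have acosK' (t : R) : 0 < t < pi -> acos (cos t) = t.
  by move=> /andP[u0 u1]; rewrite cosK // in_itv /= !ltW.
split.
  move=> r t q r0 tpi; rewrite /comp_phi.
  have := uhom _ r (cone_sph q ltr01 tpi) r0.
  rewrite {2}/sph scalerA mulr1 -/(sph r t q) expr1 => ur.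
  have -> : u (sph r t q) = r^-1 *: u (sph 1 t q).
    by rewrite ur scalerA mulVf ?scale1r // gt_eqF.
  rewrite /dot; transitivity (\sum_i r^-1 * (ep q i *
     (f t * er t q i + g t * et t q i + h t * ep q i))).
    apply: eq_bigr => i _; rewrite mxE uE // (_ : e_phi t q 0 i = ep q i) //.
    by ring.
  by rewrite -mulr_sumr frame_dot_ep h0 // mulr0.
exists c3, U; split=> //.
  move=> t q tpi; apply/rowP => j.
  have st := sin_gt0_pi tpi.
  rewrite uE // h0 // mul0r addr0 mxE [X in _ = X + _]mxE [X in _ = _ + X]mxE.
  have c1 := cos_itv t tpi.
  by rewrite (dU _ c1) -(axis_dist_cos tpi) (US _ c1) (acosK' t tpi).
have speedE t q : 0 < t < pi ->
    enorm (u (sph 1 t q)) = Num.sqrt (f t ^+ 2 + g t ^+ 2).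
  by move=> tpi; rewrite (enorm_polar (fun j => uE t q j tpi)) h0 // expr0n addr0.
have N1 (y : R) : -1 < y < 1 -> -1 < - y < 1 by lra.
have axis_distN (y : R) : axis_dist (- y) = axis_dist y :> R.
  by rewrite /axis_dist sqrrN.
have Ub y : -1 < y < 1 -> axis_dist y < d -> `|derive1 U y| <= M * `|ln (axis_dist y)|.
  move=> y1; rewrite dU // -sin_acos_itv // => yd.
  exact: fb (acos_itv y1) yd.
have pole0 s : s ^+ 2 = 1 -> U s = 0.
  by move=> s2; rewrite /U /of_polar axis_dist_pole // mulr0.
move=> s s2.
have : (s - 1) * (s + 1) = 0 by rewrite -subr_sqr_1 s2 subrr.
move/eqP; rewrite mulf_eq0 subr_eq0 addr_eq0 => /orP[|] /eqP sE.
- apply: (pole_limit s2 HU (pole0 1 (expr1n _ _)) d01 _ Ub) => y q y1.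
  by rewrite sE mul1r speedE ?acos_itv // /planar_speed dU // US.
- have dV y : -1 < y < 1 -> derive1 (fun y => - U (- y)) y = derive1 U (- y).
    move=> y1; apply: isd_val; apply: reflect_derive.
    by case: (Utheta_derive HU (N1 y y1)).
  have V1 : - U (- 1) = 0 by rewrite pole0 ?oppr0 // sqrrN expr1n.
  apply: (pole_limit s2 (Utheta_ode_reflect HU) V1 d01 (M := M)) => y.
  + move=> q y1; rewrite sE mulN1r speedE ?acos_itv ?N1 // /planar_speed dV //.
    by rewrite dU ?N1 // mulNr sqrrN -[axis_dist y]axis_distN US ?N1.
  + by move=> y1 yd; rewrite dV // -[axis_dist y]axis_distN Ub ?N1 // axis_distN.
Qed.

End Structure.

(** * Solutions regular at one pole, and the theorem *)

Section OnePole.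
Variable R : realType.
Implicit Types (u : 'rV[R]_3 -> 'rV[R]_3) (s : R).

Lemma solution_restrict (A B : set 'rV[R]_3) u : A `<=` B ->
  homogeneous_axisym_solution B u -> homogeneous_axisym_solution A u.
Proof.
move=> AB [uC2 uhom uaxi [p [pC1 phom uNS]]].
have cAB x : cone A x -> cone B x by case=> x0 /AB.
split.
- by split=> [x /cAB/uC2.1 //|i x /cAB]; exact: uC2.2.
- by move=> x l /cAB; exact: uhom.
- exact: uaxi.
- exists p; split.
  + by move=> x /cAB/pC1.
  + by move=> x l /cAB; exact: phom.
  + by move=> x /cAB/uNS.
Qed.

Lemma enorm_cvg (F : set_system 'rV[R]_3) {FF : Filter F} u (v : 'rV[R]_3) :
  u x @[x --> F] --> v -> enorm (u x) @[x --> F] --> enorm v.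
Proof.
move=> uv; have uj j : u x 0 j @[x --> F] --> v 0 j.
  exact: (cvg_comp _ _ uv (@coord_continuous R 1 3 0 j v)).
have dv : dot (u x) (u x) @[x --> F] --> dot v v.
  rewrite /dot; under eq_cvg do rewrite sum3.
  by rewrite sum3; apply: cvgD; [apply: cvgD|]; exact: cvgM.
by apply: cvg_comp dv _; exact: sqrt_continuous.
Qed.

Lemma near_axis_near_poles s (A B : set 'rV[R]_3) : s ^+ 2 = 1 ->
  nbhs (vec3 0 0 s) A -> nbhs (vec3 0 0 (- s)) B ->
  exists2 d : R, 0 < d & forall x, sphere x -> 0 < enorm' x < d -> A x \/ B x.
Proof.
move=> s2 /nbhs_ballP [a /= a0 HA] /nbhs_ballP [b /= b0 HB].
(* For [enorm' x <= 1] the distance of the height to [1] or [-1] is at most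
   [enorm' x ^ 2 <= enorm' x]. *)
exists (Num.min (Num.min a b) 1); first by rewrite !lt_min a0 b0 ltr01.
move=> x sx /andP[x0]; rewrite !lt_min => /andP[/andP[xa xb] x1].
have xE := enorm'_sphere sx; have := sx => /sphereE H.
have e2 : enorm' x ^+ 2 = x 0 0 ^+ 2 + x 0 1 ^+ 2.
  by rewrite /enorm' sqr_sqrtr // addr_ge0 // sqr_ge0.
have x0e : `|x 0 0| <= enorm' x.
  by rewrite /enorm' -sqrtr_sqr ler_wsqrtr // lerDl sqr_ge0.
have x1e : `|x 0 1| <= enorm' x.
  by rewrite /enorm' -sqrtr_sqr ler_wsqrtr // lerDr sqr_ge0.
have near (t c : R) : t ^+ 2 = 1 -> enorm' x < c -> 0 <= t * height x ->
    ball (vec3 0 0 t) c x.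
  move=> t2 xc tx; rewrite -ball_normE /= /ball_ /=.
  rewrite [X in X < _]/Num.Def.normr /= mx_normrE.
  have c0 : 0 < c by exact: lt_trans xc.
  apply: bigmax_lt => // -[i j] _; rewrite !mxE /= (ord1 i).
  case: j => -[|[|[|//]]] hj /=.
  - rewrite sub0r normrN; apply: le_lt_trans xc; apply: le_trans x0e.
    by rewrite le_eqVlt; apply/orP; left; apply/eqP; congr (`|x _ _|); exact/val_inj.
  - rewrite sub0r normrN; apply: le_lt_trans xc; apply: le_trans x1e.
    by rewrite le_eqVlt; apply/orP; left; apply/eqP; congr (`|x _ _|); exact/val_inj.
  - have -> : x 0 (Ordinal hj) = height x by congr (x _ _); exact/val_inj.
    have tE : `|t - height x| = `|1 - t * height x|.
      have t1 : `|t| = 1.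
        apply/eqP; rewrite -(@eqrXn2 _ 2) ?normr_ge0 //.
        by rewrite -normrX t2 normr1 expr1n.
      have -> : 1 - t * height x = t * (t - height x) by rewrite mulrBr -expr2 t2.
      by rewrite normrM t1 mul1r.
    have th2 : (t * height x) ^+ 2 = 1 - enorm' x ^+ 2.
      by rewrite exprMn t2 mul1r e2; move: H; lra.
    have th : `|t - height x| <= enorm' x.
      by rewrite tE ler_norml; apply/andP; split; nra.
    exact: le_lt_trans th xc.
have [h0|h0] := leP 0 (s * height x).
  by left; apply: HA; exact: near.
by right; apply: HB; apply: near; rewrite ?sqrrN // mulNr oppr_ge0 ltW.
Qed.

(** A flow that is smooth across one pole has a vanishing limit there, hence
    [c_3 = 0], and so cannot be singular at the other pole. *)
Lemma one_pole_regular s u : s ^+ 2 = 1 ->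
  homogeneous_axisym_solution (sphere `\ vec3 0 0 s) u ->
  (limf_esup (fun x => (enorm (u x) / `|ln (enorm' x)|)%:E)
     (to_pole (vec3 0 0 s)) < +oo)%E ->
  (limf_esup (fun x => (enorm (u x) / `|ln (enorm' x)|)%:E)
     (to_pole (vec3 0 0 s)) <= 0)%E.
Proof.
move=> s2 usol ubdd.
pose Q : 'rV[R]_3 := vec3 0 0 (- s).
have sQ : (sphere `\ vec3 0 0 s) Q.
  split; first by apply/sphereE; rewrite /height !mxE /= sqrrN s2; ring.
  move=> /(congr1 (fun v : 'rV[R]_3 => v 0 2%:R)); rewrite !mxE /= => E.
  by have : s = 0 by [lra]; move=> s0; move: s2; rewrite s0 expr0n /=; lra.
have s2N : (- s) ^+ 2 = 1 by rewrite sqrrN.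
have cQ : cone (sphere `\ vec3 0 0 s) Q.
  have [s1 _] := sQ; split; last by rewrite s1 invr1 scale1r.
  apply/eqP => Q0; move: s1; rewrite /sphere /= Q0 /enorm dot_sum3 !mxE.
  by rewrite !mulr0 !addr0 sqrtr0; lra.
have uc : u x @[x --> Q] --> u Q.
  by have [uC2 _ _ _] := usol; have [/differentiable_continuous] := uC2.1 Q cQ.
have ec := enorm_cvg (FF := nbhs_filter Q) uc.
have usol2 : homogeneous_axisym_solution (sphere `\` [set south; north]) u.
  apply: solution_restrict usol => x [sx xP]; split=> // xs; apply: xP.
  have : (s - 1) * (s + 1) = 0 by rewrite -subr_sqr_1 s2 subrr.
  move/eqP; rewrite mulf_eq0 subr_eq0 addr_eq0 => /orP[|] /eqP sE;
    rewrite /= xs sE.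
    by right.
  by left.
have uaxis : (limf_esup (fun x => (enorm (u x) / `|ln (enorm' x)|)%:E) to_axis < +oo)%E.
  have [A [M [FA M0 AM]]] := limf_esup_bounded ubdd.
  have HB : nbhs Q [set x | enorm (u x) < enorm (u Q) + 1].
    have lt1 : enorm (u Q) < enorm (u Q) + 1 by rewrite ltrDl ltr01.
    exact: (@cvgr_lt _ _ _ (nbhs_filter _) _ _ ec _ lt1).
  have [d d0 Hd] := near_axis_near_poles s2 FA HB.
  (* Closer to the axis than [exp (-1)], the denominator [|ln |x'||] is at
     least [1]. *)
  pose d' := Num.min d (expR (-1)).
  apply: le_lt_trans (@limf_esup_le R _ _ _ _
     [set x | sphere x /\ 0 < enorm' x < d'] (Num.max M (enorm (u Q) + 1)) _ _) _.
  - by exists d' => //=; rewrite lt_min d0 expR_gt0.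
  - move=> x [sx /andP[x0]]; rewrite lt_min => /andP[xd xe].
    rewrite le_max; have [|Ax|Bx] := Hd x sx; first by rewrite x0 xd.
      rewrite AM //; apply: Ax; split=> // xP.
      move: x0; rewrite xP /enorm' !mxE /= expr0n /= addr0 sqrtr0 ltxx //.
    apply/orP; right; have l1 : 1 <= `|ln (enorm' x)|.
      have : ln (enorm' x) < -1.
        by rewrite -[ltRHS]expRK ltr_ln ?posrE ?expR_gt0.
      by move=> l1; rewrite ltr0_norm; lra.
    rewrite ler_pdivrMr; last by lra.
    apply: (le_trans (ltW Bx)); rewrite ler_peMr //.
    by rewrite addr_ge0 // sqrtr_ge0.
  - exact: ltry.
have [_ [c3 [U [_ _ lims]]]] := solution_description usol2 uaxis.
have c30 : c3 = 0.
  have l1 := cvg_comp _ _ (pole_curve s2N) (lims _ s2N).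
  have QF : vec3 (axis_dist y) 0 (- s * y) @[y --> (1 : R)^'-] --> Q.
    by apply: cvg_trans (pole_curve s2N) _; exact: cvg_within.
  have l2 := cvg_comp _ _ QF ec.
  have l3 : (ln (axis_dist y))^-1 @[y --> (1 : R)^'-] --> (0 : R).
    have lneg : \forall y \near (1 : R)^'-, ln (axis_dist y) < 0.
      by move/cvgrNy_lt : (@ln_axis_dist_cvg R); apply.
    by apply/(ltr0_cvgV0 lneg).2; exact: ln_axis_dist_cvg.
  have l4 : enorm (u (vec3 (axis_dist y) 0 (- s * y))) / ln (axis_dist y)
      @[y --> (1 : R)^'-] --> (0 : R).
    by rewrite -[X in _ --> X](mulr0 (enorm (u Q))); apply: cvgM l3; exact: l2.
  have l5 : enorm (u (vec3 (axis_dist y) 0 (- s * y))) / ln (axis_dist y)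
      @[y --> (1 : R)^'-] --> - 2 * `|c3|.
    apply: cvg_trans l1; apply: near_eq_cvg; near=> y => /=.
    have y1 : 2^-1 < y < 1 by near: y; exact: near_left1.
    have a0 : 0 < axis_dist y by apply: axis_dist_gt0; lra.
    congr (_ / ln _).
    by rewrite /enorm' !mxE /= expr0n addr0 sqrtr_sqr gtr0_norm.
  have E : - 2 * `|c3| = 0 :> R by exact: (norm_cvg_unique l5 l4).
  by move/eqP: E; rewrite mulf_eq0 oppr_eq0 pnatr_eq0 /= normr_eq0 => /eqP.
have l0 := lims s s2; rewrite c30 normr0 mulr0 in l0.
apply/lee_addgt0Pr => e e0; rewrite add0e.
have FA : to_pole (vec3 0 0 s) [set x | `|enorm (u x) / ln (enorm' x)| < e].
  by move/cvgr0Pnorm_lt : l0; apply.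
apply: (limf_esup_le FA) => x /ltW; apply: le_trans.
by rewrite normrM normfV ler_wpM2r ?invr_ge0 // ler_norm.
Unshelve. all: by end_near. Qed.

End OnePole.

Unset Implicit Arguments.
Set Strict Implicit.

Theorem lemma3p1 (R : realType) :
  (forall u : 'rV[R]_3 -> 'rV[R]_3,
     homogeneous_axisym_solution (sphere `\` [set south; north]) u ->
     (limf_esup (fun x => (enorm (u x) / `|ln (enorm' x)|)%:E) to_axis
        < +oo)%E ->
     no_swirl u /\
     exists c1 c2 c3 gamma : R,
       [/\ in_I c1 c2 c3 gamma, c1 = 0, c2 = 0,
           is_u_c_gamma c1 c2 c3 gamma u &
           (enorm (u x) / ln (enorm' x) @[x --> to_pole south] --> - 2 * `|c3|)
           /\
           (enorm (u x) / ln (enorm' x) @[x --> to_pole north] --> - 2 * `|c3|)])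
  /\
  (forall P : 'rV[R]_3, P = south \/ P = north ->
     ~ exists u : 'rV[R]_3 -> 'rV[R]_3,
         homogeneous_axisym_solution (sphere `\ P) u /\
         (0 < limf_esup (fun x => (enorm (u x) / `|ln (enorm' x)|)%:E)
                (to_pole P) < +oo)%E).
Proof.
split=> [u usol ubdd|P Ppole [u [usol /andP[ugt0 ulty]]]].
  have [nosw [c3 [U [HU uE lims]]]] := solution_description usol ubdd.
  split=> //; exists 0, 0, c3, (U 0); split=> //.
  - exact: Utheta_in_I.
  - exists U => //; split=> // V HV V0.
    exact: Utheta_unique HU HV V0.
  - by split; apply: lims; rewrite ?sqrrN expr1n.
have [s [s2 PE]] : exists s : R, s ^+ 2 = 1 /\ P = vec3 0 0 s.
  by case: Ppole => ->; [exists (-1) | exists 1]; rewrite ?sqrrN expr1n.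
rewrite PE in usol ugt0 ulty.
by have := one_pole_regular s2 usol ulty; rewrite leNgt ugt0.
Qed.
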